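(* Let $f_1,\dots,f_N:\mathbb{R}^N\to\mathbb{R}$ be the players' cost functions. Suppose that: (1) each $f_i$ is a $\mathcal{C}^2$ function; (2) the players are equipped with a communication graph $\mathcal{G}$ on the node set $\{1,\dots,N\}$ which is undirected and connected; (3) there exists a constant $m>0$ such that $(\mathbf{x}-\mathbf{z})^T(\bar{\mathcal{P}}(\mathbf{x})-\bar{\mathcal{P}}(\mathbf{z}))\ge m\|\mathbf{x}-\mathbf{z}\|^2$ for all $\mathbf{x},\mathbf{z}\in\mathbb{R}^N$, where $\bar{\mathcal{P}}(\mathbf{x})=[\nabla_1f_1(\mathbf{x}),\dots,\nabla_Nf_N(\mathbf{x})]^T$; (4) the entries of the matrix $H(\mathbf{x})=\left[\frac{\partial^2f_i(\mathbf{x})}{\partial x_i\partial x_j}\right]$ are bounded for $\mathbf{x}\in\mathbb{R}^N$. Let $K_i>0$ and $\bar\theta_{ij}>0$, $i,j\in\{1,\dots,N\}$, be fixed constants. For $\theta,\theta_1>0$ put $\bar K_i=\theta_1K_i$ and $\theta_{ij}=\theta\theta_1\bar\theta_{ij}$, and consider the system, for $i,j\in\{1,\dots,N\}$, $$\dot x_i=\nu_i,\qquad \dot\nu_i=-(x_i-z_i)-(\nu_i-\dot z_i),\qquad \dot z_i=-\bar K_i\nabla_if_i(\mathbf{y}_i),$$ $$\dot y_{ij}=-\theta_{ij}\Big(\sum_{k=1}^Na_{ik}(y_{ij}-y_{kj})+a_{ij}(y_{ij}-z_j)\Big).$$ Then there exists a positive constant $\theta^*$ such that for each $\theta\in(\theta^*,\infty)$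 there exists a positive constant $\theta_1^*(\theta)$ such that for each $\theta_1\in(0,\theta_1^*(\theta))$ the Nash equilibrium is globally asymptotically stable, i.e. the equilibrium $(\mathbf{x},\nu,\mathbf{z},\mathbf{y})=(\mathbf{x}^*,\mathbf{0},\mathbf{x}^*,\mathbf{1}_N\otimes\mathbf{x}^* )$ of this system is globally asymptotically stable.
   Context: There is a game with $N\ge 2$ players; player $i$ has action $x_i\in\mathbb{R}$ and cost function $f_i(\mathbf{x})$, $\mathbf{x}=[x_1,\dots,x_N]^T$. Also write $f_i(\mathbf{x})=f_i(x_i,\mathbf{x}_{-i})$ with $\mathbf{x}_{-i}=[x_1,\dots,x_{i-1},x_{i+1},\dots,x_N]^T$. Notation: $\nabla_if_i(\mathbf{x})=\frac{\partial f_i(\mathbf{x})}{\partial x_i}$; $\nu=[\nu_1,\dots,\nu_N]^T$; $z_i,y_{ij}\in\mathbb{R}$ are auxiliary variables, $\mathbf{z}=[z_1,\dots,z_N]^T$, $\mathbf{y}_i=[y_{i1},\dots,y_{iN}]^T\in\mathbb{R}^N$, $\mathbf{y}=[\mathbf{y}_1^T,\dots,\mathbf{y}_N^T]^T\in\mathbb{R}^{N^2}$; $\nabla_if_i(\mathbf{y}_i)=\frac{\partial f_i(\mathbf{x})}{\partial x_i}\big|_{\mathbf{x}=\mathbf{y}_i}$; $\mathbf{1}_N\in\mathbb{R}^N$ is the all-ones vector and $\otimes$ the Kronecker product. In the equation for $\dot\nu_i$, $\dot z_i$ stands for the expression $-\bar K_i\nabla_if_i(\mathbf{y}_i)$. $a_{ij}$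 is the $(i,j)$ entry of the adjacency matrix of $\mathcal{G}$ ($a_{ij}=a_{ji}=1$ if $\{i,j\}$ is an edge, $a_{ij}=0$ otherwise, $a_{ii}=0$). A Nash equilibrium is a point $\mathbf{x}^*=(x_i^*,\mathbf{x}_{-i}^* )\in\mathbb{R}^N$ such that $f_i(x_i^*,\mathbf{x}_{-i}^* )\le f_i(x_i,\mathbf{x}_{-i}^* )$ for all $x_i\in\mathbb{R}$ and all $i$. (Under hypothesis (3) it exists and is unique, and it is the unique zero of $\bar{\mathcal P}$.) *)

(* Defs.v *)
From mathcomp Require Import all_boot all_order all_algebra.
From mathcomp Require Import all_classical all_reals all_analysis.

Set Implicit Arguments.
Unset Strict Implicit.
Unset Printing Implicit Defensive.

Import Order.TTheory GRing.Theory Num.Theory.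
Import numFieldNormedType.Exports.

Local Open Scope classical_set_scope.
Local Open Scope ring_scope.

(* Points of R^n are row vectors.  The library norm on them is the sup norm, so
   Euclidean quantities are written out as sums over coordinates. *)

Definition partial (R : realType) (n : nat) (j : 'I_n) (g : 'rV[R]_n -> R) :
    'rV[R]_n -> R :=
  fun x => 'D_(delta_mx 0 j) g x.

(* Class C^k: all iterated partial derivatives up to order k exist everywhere
   and are continuous.  'D_v is total, hence the explicit derivability. *)
Fixpoint class_C (R : realType) (n k : nat) (g : 'rV[R]_n -> R) : Prop :=
  continuous g /\
  match k with
  | 0 => True
  | k'.+1 => forall j : 'I_n,
      (forall x, derivable g x (delta_mx 0 j)) /\ class_C k' (partial j g)
  end.

Definition update (R : realType) (n : nat) (x : 'rV[R]_n) (i : 'I_n) (t : R) :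
    'rV[R]_n :=
  \row_j (if j == i then t else x 0 j).

Definition nash_equilibrium (R : realType) (n : nat)
    (f : 'I_n -> 'rV[R]_n -> R) (x : 'rV[R]_n) : Prop :=
  forall (i : 'I_n) (t : R), f i x <= f i (update x i t).

Definition pseudo_gradient (R : realType) (n : nat)
    (f : 'I_n -> 'rV[R]_n -> R) (x : 'rV[R]_n) : 'rV[R]_n :=
  \row_i partial i (f i) x.

Definition strongly_monotone (R : realType) (n : nat)
    (P : 'rV[R]_n -> 'rV[R]_n) (m : R) : Prop :=
  forall x z : 'rV[R]_n,
    m * (\sum_i (x 0 i - z 0 i) ^+ 2)
      <= \sum_i (x 0 i - z 0 i) * (P x 0 i - P z 0 i).

(* The Jacobian of the pseudo-gradient: f_i is differentiated first in x_i, then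
   in x_j (the order is immaterial for C^2 functions). *)
Definition game_hessian (R : realType) (n : nat)
    (f : 'I_n -> 'rV[R]_n -> R) (x : 'rV[R]_n) : 'M[R]_n :=
  \matrix_(i, j) partial j (partial i (f i)) x.

Definition simple_graph (n : nat) (e : rel 'I_n) : Prop :=
  symmetric e /\ irreflexive e.

Definition connected_graph (n : nat) (e : rel 'I_n) : Prop :=
  forall i j : 'I_n, connect e i j.

Definition adjacency (R : realType) (n : nat) (e : rel 'I_n) : 'M[R]_n :=
  \matrix_(i, j) (e i j)%:R.

(* Forward solutions of the autonomous equation s' = F s on [0, +oo[; values at
   negative times are irrelevant. *)
Definition solution (R : realType) (V : normedModType R) (F : V -> V)
    (s : R -> V) : Prop :=
  {within `[0, +oo[, continuous s} /\
  (forall t : R, 0 < t -> is_derive t 1 s (F (s t))).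

(* Besides Lyapunov stability and global attractivity, every initial state is
   required to admit a solution defined for all t >= 0, so that the clauses on
   solutions cannot hold vacuously. *)
Definition globally_asymptotically_stable (R : realType) (V : normedModType R)
    (F : V -> V) (se : V) : Prop :=
  [/\ F se = 0,
      forall s0 : V, exists s : R -> V, solution F s /\ s 0 = s0,
      forall eps : R, 0 < eps -> exists2 delta : R, 0 < delta &
        forall s : R -> V, solution F s -> `|s 0 - se| < delta ->
          forall t : R, 0 <= t -> `|s t - se| < eps
    & forall s : R -> V, solution F s -> s t @[t --> +oo] --> se].

(* States (x, nu, z, y); the stacked vector y = [y_1; ...; y_N] of R^(N^2) is the
   matrix whose i-th row is y_i. *)
Definition state (R : realType) (n : nat) : normedModType R :=
  ('rV[R]_n * 'rV[R]_n * 'rV[R]_n * 'M[R]_n)%type.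

Definition seeking_dynamics (R : realType) (n : nat)
    (f : 'I_n -> 'rV[R]_n -> R) (a : 'M[R]_n)
    (Kbar : 'I_n -> R) (theta : 'I_n -> 'I_n -> R) (s : state R n) :
    state R n :=
  let: (x, nu, z, y) := s in
  let zdot : 'rV[R]_n := \row_i (- Kbar i * partial i (f i) (row i y)) in
  (nu,
   \row_i (- (x 0 i - z 0 i) - (nu 0 i - zdot 0 i)),
   zdot,
   \matrix_(i, j) (- theta i j *
     (\sum_k a i k * (y i j - y k j) + a i j * (y i j - z 0 j)))).

(* 1_N (x) x* has all its blocks y_i equal to x*. *)
Definition seeking_equilibrium (R : realType) (n : nat) (x : 'rV[R]_n) :
    state R n :=
  (x, 0, x, \matrix_(i, j) x 0 j).

(* Main.v *)
Require Import Defs.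
From mathcomp Require Import all_boot all_order all_algebra.
From mathcomp Require Import all_classical all_reals all_analysis.
From mathcomp Require Import ring lra.

Import Order.TTheory GRing.Theory Num.Theory.
Import numFieldNormedType.Exports.

(** Let P be the pseudo-gradient.  Its partial derivatives are bounded, so P is
    globally Lipschitz ([pseudo_gradient_lipschitz]); being also strongly
    monotone, a small gradient step x - gamma P x is a Euclidean contraction and
    P has exactly one zero xs.  The zeros of P are the Nash equilibria, because
    strong monotonicity makes each cost convex in its player's own action
    ([exists_unique_nash]).

    Stability comes from one quadratic Lyapunov function ([energy]).  Write
    e = z - xs for the tracking error, eta_ij = y_ij - z_j for the estimation
    error, u = x - z for the lag of the actions.  Three effects are superposed.
    - If the estimates were exact, e would obey a scaled gradient flow, whose
      weighted squared norm decays at rate m by strong monotonicity.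
    - For each j the estimates of the action of player j diffuse on the graph,
      with the Laplacian grounded at the neighbours of j.  As the graph is
      connected this matrix is positive definite
      ([grounded_laplacian_coercive]), and the decay of eta carries the factor
      theta.  A large theta absorbs the two coupling terms, the gradient error
      caused by eta in the equation of e and the drift of z in that of eta, all
      of which are bounded by quadratic expressions in e and eta.
    - (u, nu) is a damped oscillator forced by dz/dt, which is bounded by a
      multiple of |e| + |eta|.  Its energy, with a cross term u nu, is added
      with a weight mu small enough for the forcing to be absorbed.
    Hence the energy decreases at a rate proportional to itself ([energy_decay]).
    It is comparable to the squared distance to the equilibrium, so that all
    solutions converge exponentially ([lyapunov_stable],
    [lyapunov_attractive]).

    Solutions exist for all times because the field is globally Lipschitz
    ([seeking_dynamics_lipschitz]): this is the global Picard-Lindelof theorem,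
    obtained here by iterating the integral operator in an exponentially
    weighted sup norm ([lipschitz_cauchy_problem]). *)

Set Implicit Arguments.
Unset Strict Implicit.
Unset Printing Implicit Defensive.

Local Open Scope classical_set_scope.
Local Open Scope ring_scope.

(** * Geometric convergence and finite bounds *)

(** The shrinking intervals of centre [a k] and radius [D r^k / (1 - r)] are
    nested; the limit is the supremum of their left ends.  The explicit radius
    makes the convergence usable pointwise with weights that vary. *)
Lemma geometric_cauchy (R : realType) (a : nat -> R) (D r : R) :
  0 <= r -> r < 1 -> (forall k, `|a k.+1 - a k| <= D * r ^+ k) ->
  exists l : R, forall k, `|l - a k| <= D / (1 - r) * r ^+ k.
Proof.
move=> r0 r1 ha; set C := D / (1 - r).
have hC : C - C * r = D by rewrite /C; field; rewrite subr_eq0 gt_eqF.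
have step k : `|a k.+1 - a k| <= C * r ^+ k - C * r ^+ k.+1.
  by rewrite exprS mulrA -mulrBl hC.
have lo k n : a k - C * r ^+ k <= a (k + n)%N - C * r ^+ (k + n).
  elim: n => [|n IH]; first by rewrite addn0.
  apply: le_trans IH _; rewrite addnS.
  by have := step (k + n)%N; rewrite ler_norml => /andP[h _]; lra.
have up k n : a (k + n)%N + C * r ^+ (k + n) <= a k + C * r ^+ k.
  elim: n => [|n IH]; first by rewrite addn0.
  apply: le_trans _ IH; rewrite addnS.
  by have := step (k + n)%N; rewrite ler_norml => /andP[_ h]; lra.
have C0 : 0 <= C.
  rewrite /C divr_ge0 ?subr_ge0 ?(ltW r1)//.
  by have := ha 0%N; rewrite expr0 mulr1; apply: le_trans.
have Cr n : 0 <= C * r ^+ n by rewrite mulr_ge0// exprn_ge0.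
have lu k n : a k - C * r ^+ k <= a n + C * r ^+ n.
  have [kn|nk] := leqP k n.
    rewrite -(subnKC kn); apply: le_trans (lo k (n - k)%N) _.
    by have := Cr (k + (n - k))%N; lra.
  rewrite -(subnKC (ltnW nk)); apply: le_trans _ (up n (k - n)%N).
  by have := Cr (n + (k - n))%N; lra.
pose A := [set a k - C * r ^+ k | k in [set: nat]].
have Aub k : ubound A (a k + C * r ^+ k) by move=> _ [n _ <-].
exists (sup A) => k; rewrite ler_distl; apply/andP; split.
  by apply: ub_le_sup; [exists (a 0%N + C * r ^+ 0) | exists k].
by apply: ge_sup; [exists (a 0%N - C * r ^+ 0), 0%N | ].
Qed.

Lemma geometric_bound_eq0 (R : realType) (x C r : R) :
  0 <= r -> r < 1 -> (forall k, `|x| <= C * r ^+ k) -> x = 0.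
Proof.
move=> r0 r1 hx; apply/normr0_eq0/eqP; rewrite eq_le normr_ge0 andbT.
have h : geometric C r @ \oo --> (0 : R) by apply: cvg_geometric; rewrite ger0_norm.
by apply: (ler_cvg_to (cvg_cst _) h); apply: nearW.
Qed.

Lemma finite_upper_bound (R : realType) (I : finType) (w : I -> R) :
  exists2 B : R, 0 < B & forall i, w i <= B.
Proof.
have S0 (J : pred I) : 0 <= \sum_(i | J i) `|w i| by apply: sumr_ge0.
exists (1 + \sum_i `|w i|) => [|i]; first by rewrite ltr_wpDr.
rewrite (bigD1 i)//= addrCA; apply: le_trans (ler_norm _) _.
by rewrite lerDl addr_ge0.
Qed.

Lemma finite_lower_bound (R : realType) (I : finType) (w : I -> R) :
  (forall i, 0 < w i) -> exists2 B : R, 0 < B & forall i, B <= w i.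
Proof.
move=> w0; have [B B0 hB] := finite_upper_bound (fun i => (w i)^-1).
by exists B^-1 => [|i]; rewrite ?invr_gt0// invf_ple ?posrE.
Qed.

(** * Curves in a finite-dimensional space, by coordinates *)

Section Coordinates.
Variables (R : realType) (V : normedModType R) (I : finType).
Variables (c : I -> V -> R) (mk : (I -> R) -> V).

(** [c] identifies [V] with the functions on the finite set [I] under the sup
    norm, [mk] being the inverse identification.  Through it, statements on
    curves in a product of matrix spaces become statements on real functions,
    for which integrals and the mean value theorem are available. *)
Definition sup_coordinates :=
  [/\ forall i a u v, c i (a *: u + v) = a * c i u + c i v,
      forall v b, 0 <= b -> (`|v| <= b <-> forall i, `|c i v| <= b)
    & forall w i, c i (mk w) = w i].

Hypothesis hc : sup_coordinates.

Lemma coordB i u v : c i (u - v) = c i u - c i v.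
Proof. by case: hc => lin _ _; rewrite addrC -scaleN1r lin mulN1r addrC. Qed.

Lemma coordZ i a u : c i (a *: u) = a * c i u.
Proof.
case: hc => lin _ _; have := lin i a u 0; rewrite addr0 => ->.
by have := lin i (-1) 0 0; rewrite scaler0 addr0 mulN1r addNr => ->; rewrite addr0.
Qed.

Lemma coord_norm_le i v : `|c i v| <= `|v|.
Proof. by case: hc => _ nrm _; apply: (nrm v `|v| _).1. Qed.

Lemma norm_le_coord v b : 0 <= b -> (forall i, `|c i v| <= b) -> `|v| <= b.
Proof. by case: hc => _ nrm _ b0 h; apply/nrm. Qed.

Lemma coord_mk w i : c i (mk w) = w i.
Proof. by case: hc. Qed.

Lemma cvg_coord (T : Type) (F : set_system T) {FF : Filter F} (g : T -> V) (l : V) :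
  g @ F --> l <-> forall i, c i (g t) @[t --> F] --> c i l.
Proof.
split=> [gl i|gl].
  apply/cvgrPdist_le => e e0; move/cvgrPdist_le : gl => /(_ e e0).
  by apply: filterS => t; apply: le_trans; rewrite -coordB coord_norm_le.
apply/cvgrPdist_le => e e0; near=> t; apply: norm_le_coord (ltW e0) _ => i.
rewrite coordB; move: i; near: t; apply: filter_forall => i.
by move/cvgrPdist_le : (gl i); apply.
Unshelve. all: by end_near. Qed.

Lemma continuous_coord (T : topologicalType) (g : T -> V) :
  continuous g <-> forall i, continuous (c i \o g).
Proof.
split=> [gc i x|gc x]; first by have /cvg_coord := gc x; exact.
by apply/cvg_coord => i; exact: gc.
Qed.

Lemma is_derive_coord (s : R -> V) (t : R) (d : V) :
  is_derive t 1 s d <-> forall i, is_derive t (1 : R) (c i \o s) (c i d).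
Proof.
have E i h : c i (h^-1 *: (s (h *: 1 + t) - s t)) =
             h^-1 *: ((c i \o s) (h *: 1 + t) - (c i \o s) t).
  by rewrite coordZ coordB.
split=> [[sd <-] i|sd].
  have /cvg_coord /(_ i) := sd.
  under eq_fun do rewrite E.
  by move=> h; apply: DeriveDef; [apply/cvg_ex; eexists; exact: h | exact: cvg_lim h].
have h : h^-1 *: (s (h *: 1 + t) - s t) @[h --> 0^'] --> d.
  apply/cvg_coord => i; under eq_fun do rewrite E.
  by have [sdi <-] := sd i; exact: sdi.
by apply: DeriveDef; [apply/cvg_ex; eexists; exact: h | exact: cvg_lim h].
Qed.

End Coordinates.

(** * Global solutions of Lipschitz differential equations *)

Section Primitive.
Variables (R : realType).

(** The base point is [-1] and not [0] so that the fundamental theorem of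
    calculus, which needs an interior point, also applies at time [0]. *)
Definition primitive (g : R -> R) (t : R) : R :=
  \int[lebesgue_measure]_(x in `[-1, t]) g x -
  \int[lebesgue_measure]_(x in `[-1, 0]) g x.

Lemma primitive0 g : primitive g 0 = 0.
Proof. exact: subrr. Qed.

Lemma is_derive_primitive (g : R -> R) (t : R) : continuous g -> -1 < t ->
  is_derive t (1 : R) (primitive g) (g t).
Proof.
move=> gc t1.
have ig : lebesgue_measure.-integrable `[-1, t + 1] (EFin \o g).
  apply: continuous_compact_integrable; first exact: segment_compact.
  exact: continuous_subspaceT.
have tt : t < t + 1 by rewrite ltrDl.
have [d e] := continuous_FTC1_closed tt ig t1 (gc t).
rewrite /primitive.
have -> : g t = g t - 0 by rewrite subr0.
apply: is_deriveB.
by apply: DeriveDef; [exact: d | rewrite -derive1E; exact: e].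
Qed.

(** Both [phi + h] and [phi - h] are nondecreasing. *)
Lemma norm_le_of_derive_le (h dh phi dphi : R -> R) :
  (forall t : R, -1 < t -> is_derive t (1 : R) h (dh t)) ->
  (forall t : R, -1 < t -> is_derive t (1 : R) phi (dphi t)) ->
  (forall t : R, 0 < t -> `|dh t| <= dphi t) ->
  `|h 0| <= phi 0 -> forall t, 0 <= t -> `|h t| <= phi t.
Proof.
move=> hd pd le h0 t t0.
have N1 (x : R) : 0 <= x -> -1 < x by apply: lt_le_trans; rewrite oppr_lt0.
have key (g dg : R -> R) : (forall t : R, -1 < t -> is_derive t (1 : R) g (dg t)) ->
    (forall t : R, 0 < t -> 0 <= dg t) -> g 0 <= g t.
  move=> gd dg0; apply: (@ger0_derive1_ndecry R g 0) => //.
  - by move=> x; rewrite in_itv/= andbT => /ltW/N1/gd gdx; exact: ex_derive.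
  - move=> x; rewrite in_itv/= andbT => x0; rewrite derive1E.
    by have [_ ->] := gd x (N1 x (ltW x0)); exact: dg0.
  - apply: derivable_within_continuous => x; rewrite in_itv/= andbT => /N1/gd gdx.
    exact: ex_derive.
have kp : phi 0 + h 0 <= phi t + h t.
  apply: (key (phi + h) (dphi + dh)) => [x x1|x /le].
    exact: (is_deriveD (pd x x1) (hd x x1)).
  by rewrite ler_norml => /andP[a b]; rewrite fctE; lra.
have km : phi 0 - h 0 <= phi t - h t.
  apply: (key (phi - h) (dphi - dh)) => [x x1|x /le].
    exact: (is_deriveB (pd x x1) (hd x x1)).
  by rewrite ler_norml => /andP[a b]; rewrite !fctE; lra.
by move: h0; rewrite !ler_norml => /andP[a b]; apply/andP; split; lra.
Qed.

End Primitive.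

Section Picard.
Variables (R : realType) (V : normedModType R) (I : finType).
Variables (c : I -> V -> R) (mk : (I -> R) -> V).
Hypothesis hc : sup_coordinates c mk.
Variables (F : V -> V) (L : R) (s0 : V).
Hypotheses (L0 : 0 < L) (lipF : forall u v, `|F u - F v| <= L * `|u - v|).

(** In the norm [sup_t |u t| / weight t] (Bielecki's norm) the Picard operator
    is a contraction of factor 1/2 on the whole half-line, so no time steps have
    to be glued together. *)
Let weight (t : R) : R := expR (2 * L * Num.max t 0).

(** Time is clamped to [0, +oo[, which keeps the iterates defined and continuous
    on all of [R] while leaving their values at negative times irrelevant. *)
Definition picard (u : R -> V) (t : R) : V :=
  mk (fun i => c i s0 + primitive (fun x => c i (F (u x))) (Num.max t 0)).

Let lip_continuous : continuous F.
Proof.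
move=> v; apply/cvgrPdist_le => e e0; near=> w.
apply: le_trans (lipF v w) _; rewrite -ler_pdivlMl//.
near: w; apply: cvgr_dist_le; [exact: cvg_id|].
by rewrite mulr_gt0// invr_gt0.
Unshelve. all: by end_near. Qed.

Let coord_field_continuous (u : R -> V) i : continuous u ->
  continuous (fun x => c i (F (u x))).
Proof.
move=> uc; apply: ((continuous_coord hc (F \o u)).1 _ i) => x.
by apply: continuous_comp; [exact: uc | exact: lip_continuous].
Qed.

Let max0_gtN1 (t : R) : -1 < Num.max t 0.
Proof. by rewrite lt_max ltrN10 orbT. Qed.

Lemma picard_continuous u : continuous u -> continuous (picard u).
Proof.
move=> uc; apply/(continuous_coord hc) => i t.
rewrite /comp; under eq_fun do rewrite (coord_mk hc).
apply: cvgD; first exact: cvg_cst.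
apply: (@continuous_comp _ _ _ (fun t : R => Num.max t 0)).
  by apply: continuous_max; [exact: cvg_id | exact: cvg_cst].
apply/differentiable_continuous/derivable1_diffP.
by have dp := is_derive_primitive (coord_field_continuous uc) (max0_gtN1 t).
Qed.

Lemma is_derive_picard u (t : R) : continuous u -> 0 < t ->
  is_derive t (1 : R) (picard u) (F (u t)).
Proof.
move=> uc t0; apply/(is_derive_coord hc) => i.
set g := fun x => c i (F (u x)).
have dp : is_derive t (1 : R) (cst (c i s0) + primitive g) (g t).
  rewrite -[g t]add0r; apply: is_deriveD.
  apply: is_derive_primitive; first exact: coord_field_continuous.
  by apply: lt_trans t0; rewrite ltrN10.
apply: near_eq_is_derive dp.
near=> x; rewrite /= (coord_mk hc) fctE.
by rewrite max_l//; apply/ltW; near: x; exact: lt_nbhsr.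
Unshelve. all: by end_near. Qed.

Let is_derive_exp (B t : R) :
  is_derive t (1 : R) (fun x => B * expR (2 * L * x)) (B * (2 * L * expR (2 * L * t))).
Proof.
have h : is_derive t (1 : R) ((2 * L) *: id) ((2 * L) *: 1) by exact: is_deriveZ.
have h' := is_derive1_comp (is_derive_expR _) h.
apply: is_derive_eq (is_deriveZ B h') _.
by rewrite /= [_ *: 1]mulr1 mulrC.
Qed.

Let weight_ge0E t : 0 <= t -> weight t = expR (2 * L * t).
Proof. by move=> t0; rewrite /weight max_l. Qed.

(** Integrating [L * weight] gives at most [weight / 2]: this is where the
    exponent [2 L] of the weight comes from. *)
Let le_weight (h dh : R -> R) (B : R) : 0 <= B -> h 0 = 0 ->
  (forall x : R, -1 < x -> is_derive x (1 : R) h (dh x)) ->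
  (forall x : R, 0 < x -> `|dh x| <= B * L * weight x) ->
  forall t : R, `|h (Num.max t 0)| <= B / 2 * weight t.
Proof.
move=> B0 h0 hd dhB t; have t0 : 0 <= Num.max t 0 by rewrite le_max lexx orbT.
apply: (norm_le_of_derive_le hd (phi := fun x => B / 2 * expR (2 * L * x))
  (dphi := fun x => B / 2 * (2 * L * expR (2 * L * x)))) => // [x x0|].
- have := dhB x x0; rewrite weight_ge0E ?(ltW x0)//.
  by move=> /le_trans; apply; rewrite le_eqVlt; apply/orP; left; apply/eqP; field.
- by rewrite h0 normr0 mulr_ge0 ?expR_ge0 ?divr_ge0.
Qed.

Lemma picard_contraction (u v : R -> V) (B : R) : 0 <= B ->
  continuous u -> continuous v ->
  (forall t, `|u t - v t| <= B * weight t) ->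
  forall t, `|picard u t - picard v t| <= B / 2 * weight t.
Proof.
move=> B0 uc vc uv t; apply: (norm_le_coord hc).
  by rewrite mulr_ge0 ?expR_ge0 ?divr_ge0.
move=> i; rewrite (coordB hc) !(coord_mk hc) opprD addrACA subrr add0r.
set g := fun x => c i (F (u x)); set h := fun x => c i (F (v x)).
apply: (le_weight (h := primitive g - primitive h) (dh := g - h)) => //.
- by rewrite !fctE !primitive0 subrr.
- by move=> x x1; apply: is_deriveB;
    apply: is_derive_primitive => //; exact: coord_field_continuous.
- move=> x x0; rewrite /g /h !fctE -(coordB hc).
  apply: le_trans (coord_norm_le hc _ _) _; apply: le_trans (lipF _ _) _.
  by have := ler_wpM2l (ltW L0) (uv x); lra.
Qed.

Let iterate k := iter k picard (cst s0).

Let iterate_continuous k : continuous (iterate k).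
Proof.
by elim: k => [|k IH]; [exact: cst_continuous | exact: picard_continuous].
Qed.

Let weight_ge1 t : 1 <= weight t.
Proof.
by rewrite -expR0 ler_expR mulr_ge0 ?mulr_ge0 ?(ltW L0)// le_max lexx orbT.
Qed.

Let C := 2 * `|F s0| / L.

Let C_ge0 : 0 <= C.
Proof. by rewrite divr_ge0 ?mulr_ge0 ?(ltW L0). Qed.

Let iterate_step k t :
  `|iterate k.+1 t - iterate k t| <= C * weight t * 2^-1 ^+ k.
Proof.
elim: k t => [|k IH] t; last first.
  rewrite exprSr [leRHS](_ : _ = (C * 2^-1 ^+ k) / 2 * weight t); last by ring.
  apply: (@picard_contraction (iterate k.+1) (iterate k)) => //.
    by rewrite mulr_ge0// exprn_ge0.
  by move=> x; apply: le_trans (IH x) _; rewrite mulrAC.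
rewrite expr0 mulr1; apply: (norm_le_coord hc).
  by rewrite mulr_ge0// expR_ge0.
move=> i; rewrite (coordB hc) (coord_mk hc) addrC addKr.
apply: (@le_trans _ _ (C / 2 * weight t)); last first.
  by rewrite ler_wpM2r ?expR_ge0//; have := C_ge0; lra.
apply: (le_weight (dh := fun x => c i (F s0))) => //.
- exact: primitive0.
- by move=> x x1; apply: (is_derive_primitive (g := fun x => c i (F s0))) => //;
    exact: cst_continuous.
- move=> x x0; apply: le_trans (coord_norm_le hc _ _) _.
  rewrite /C divfK ?gt_eqF//.
  have := weight_ge1 x; have := normr_ge0 (F s0); nra.
Qed.

(** The Picard iterates converge geometrically, locally uniformly in time; their
    limit is continuous and is fixed by the Picard operator, hence solves the
    equation. *)
Lemma lipschitz_cauchy_problem : exists s : R -> V, solution F s /\ s 0 = s0.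
Proof.
have half_ge0 : 0 <= 2^-1 :> R by rewrite invr_ge0.
have half_lt1 : 2^-1 < 1 :> R by rewrite invf_lt1// ltr1n.
have C2 : 0 <= 2 * C by rewrite mulr_ge0.
have lim t i : exists l : R, forall k,
    `|l - c i (iterate k t)| <= 2 * C * weight t * 2^-1 ^+ k.
  have [] := @geometric_cauchy _ (fun k => c i (iterate k t)) (C * weight t)
    2^-1 half_ge0 half_lt1.
    move=> k; rewrite -(coordB hc).
    exact: le_trans (coord_norm_le hc _ _) (iterate_step k t).
  move=> l hl; exists l => k; apply: le_trans (hl k) _.
  by rewrite le_eqVlt; apply/orP; left; apply/eqP; field.
pose l t := projT1 (choice (lim t)); have hl t := projT2 (choice (lim t)).
pose s t := mk (l t).
have sE k t : `|s t - iterate k t| <= 2 * C * weight t * 2^-1 ^+ k.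
  apply: (norm_le_coord hc) => [|i].
    by rewrite mulr_ge0 ?exprn_ge0// mulr_ge0 ?expR_ge0.
  by rewrite (coordB hc) (coord_mk hc); exact: hl.
have sc : continuous s.
  move=> t; apply/cvgrPdist_le => e e0.
  (* The weight is increasing, so its value at t + 1 bounds it near t. *)
  pose w := weight (t + 1).
  have [k hk] : exists k, 2 * C * w * 2^-1 ^+ k <= e / 3.
    have h : geometric (2 * C * w) 2^-1 @ \oo --> (0 : R).
      by apply: cvg_geometric; rewrite ger0_norm.
    have e3 : 0 < e / 3 by rewrite divr_gt0.
    move/cvgrPdist_le : h => /(_ _ e3) [k _ /(_ k (leqnn k))] /= hk.
    by exists k; move: hk; rewrite sub0r normrN; apply: le_trans; exact: ler_norm.
  have near_s x : x <= t + 1 -> `|s x - iterate k x| <= e / 3.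
    move=> x1; apply: le_trans (sE k x) _; apply: le_trans hk.
    rewrite ler_wpM2r ?exprn_ge0// ler_wpM2l// ler_expR.
    rewrite ler_wpM2l ?mulr_ge0 ?(ltW L0)// ge_max !le_max x1 lexx orbT//.
  near=> x.
  rewrite (_ : s t - s x = (s t - iterate k t) + (iterate k t - iterate k x)
     + (iterate k x - s x)); last by rewrite !addrA !subrK.
  apply: le_trans (ler_normD _ _) _.
  have -> : e = e / 3 + e / 3 + e / 3 by field.
  apply: lerD; last first.
    rewrite distrC; apply: near_s; apply/ltW; near: x; apply: lt_nbhsl.
    by rewrite ltrDl.
  apply: le_trans (ler_normD _ _) _; apply: lerD.
    by apply: near_s; rewrite lerDl.
  near: x; apply: cvgr_dist_le; [exact: iterate_continuous | exact: divr_gt0].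
have fixs t : picard s t = s t.
  apply/eqP; rewrite -subr_eq0 -normr_eq0; apply/eqP.
  apply: (@geometric_bound_eq0 _ _ (2 * C * weight t) 2^-1) => // k.
  rewrite normr_id.
  rewrite (_ : _ - _ = (picard s t - iterate k.+1 t) + (iterate k.+1 t - s t));
    last by rewrite addrA subrK.
  apply: le_trans (ler_normD _ _) _.
  have -> : 2 * C * weight t * 2^-1 ^+ k =
     (2 * C * 2^-1 ^+ k) / 2 * weight t + 2 * C * weight t * 2^-1 ^+ k.+1.
    by rewrite exprSr; field.
  apply: lerD; last by rewrite distrC.
  apply: (@picard_contraction s (iterate k)) => //; first by rewrite mulr_ge0 ?exprn_ge0.
  by move=> x; apply: le_trans (sE k x) _; rewrite mulrAC.
exists s; split; last first.
  apply/eqP; rewrite -subr_eq0 -normr_le0 -fixs; apply: (norm_le_coord hc) => // i.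
  by rewrite (coordB hc) (coord_mk hc) addrC addKr maxxx primitive0 normr0.
split; first exact: continuous_subspaceT.
move=> t t0; have -> : s = picard s by apply/funext => x; rewrite fixs.
by rewrite fixs; exact: is_derive_picard.
Unshelve. all: by end_near. Qed.

End Picard.

(** * Exponential stability from a Lyapunov function *)

Section Lyapunov.
Variables (R : realType) (V : normedModType R) (F : V -> V) (se : V).
Variables (U dU : V -> R) (a b c : R).
Hypotheses (a0 : 0 < a) (b0 : 0 < b) (c0 : 0 < c).
Hypotheses (U_lower : forall v, a * `|v - se| ^+ 2 <= U v)
           (U_upper : forall v, U v <= b * `|v - se| ^+ 2).
Hypothesis U_continuous : continuous U.
Hypothesis U_derive : forall (s : R -> V) (t : R), is_derive t 1 s (F (s t)) ->
  is_derive t (1 : R) (U \o s) (dU (s t)).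
Hypothesis U_decay : forall v, dU v <= - c * U v.

(** The function [t |-> exp (c t) * U (s t)] has a nonpositive derivative. *)
Lemma lyapunov_exp_decay s : solution F s ->
  forall t : R, 0 <= t -> expR (c * t) * U (s t) <= U (s 0).
Proof.
move=> [sc sd] t t0.
pose g := (fun t => expR (c * t)) * (U \o s).
have eD (x : R) : is_derive x (1 : R) (fun t => expR (c * t)) (expR (c * x) * c).
  have h : is_derive x (1 : R) (c *: id) (c *: 1) by exact: is_deriveZ.
  have h' := is_derive1_comp (is_derive_expR _) h.
  by apply: is_derive_eq h' _; rewrite /= [_ *: 1]mulr1.
have gD (x : R) : 0 < x ->
    is_derive x (1 : R) g (expR (c * x) * (dU (s x) + c * U (s x))).
  move=> x0; apply: is_derive_eq (is_deriveM (eD x) (U_derive (sd x x0))) _.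
  by rewrite /= /GRing.scale/=; ring.
have -> : U (s 0) = g 0 by rewrite /g fctE mulr0 expR0 mul1r.
have -> : expR (c * t) * U (s t) = g t by [].
apply: (@ler0_derive1_nincry R g 0) => //.
- by move=> x; rewrite in_itv/= andbT => /gD ?; exact: ex_derive.
- move=> x; rewrite in_itv/= andbT => x0; rewrite derive1E.
  have [_ ->] := gD x x0; rewrite mulr_ge0_le0 ?expR_ge0//.
  by have := U_decay (s x); lra.
- move=> x; apply: continuousM.
    apply: continuous_subspaceT => y; apply: differentiable_continuous.
    by apply/derivable1_diffP; have := eD y.
  apply: continuous_comp; first exact: sc.
  exact: U_continuous.
Qed.

Lemma lyapunov_stable (eps : R) : 0 < eps -> exists2 delta : R, 0 < delta &
  forall s : R -> V, solution F s -> `|s 0 - se| < delta ->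
    forall t : R, 0 <= t -> `|s t - se| < eps.
Proof.
(* The exact ratio would be sqrt (a / b); as k <= 1, b k ^ 2 <= b k <= a. *)
move=> eps0; pose k := Num.min 1 (a / b).
have k0 : 0 < k by rewrite lt_min ltr01 divr_gt0.
exists (eps * k); first by rewrite mulr_gt0.
move=> s hs s0 t t0.
have dec := lyapunov_exp_decay hs t0.
have e1 : 1 <= expR (c * t) by rewrite -expR0 ler_expR mulr_ge0// ltW.
have lo := U_lower (s t); have up := U_upper (s 0).
have n0 := normr_ge0 (s 0 - se).
have q0 : 0 <= a * `|s t - se| ^+ 2 by rewrite mulr_ge0 ?(ltW a0)// exprn_ge0.
have lt : a * `|s t - se| ^+ 2 < a * eps ^+ 2.
  apply: le_lt_trans lo _; apply: (@le_lt_trans _ _ (U (s 0))).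
    by apply: le_trans dec; rewrite ler_peMl// (le_trans q0).
  apply: le_lt_trans up _; apply: (@lt_le_trans _ _ (b * (eps * k) ^+ 2)).
    by rewrite ltr_pM2l// ltrXn2r.
  have kb : b * k <= a by rewrite mulrC -ler_pdivlMr// ge_min lexx orbT.
  have k1 : k <= 1 by rewrite ge_min lexx.
  rewrite exprMn mulrCA mulrC ler_pM2r ?exprn_gt0//.
  apply: le_trans kb; rewrite expr2 mulrA ler_piMr// mulr_ge0// ltW//.
move: lt; rewrite ltr_pM2l// ltr_pXn2r// ?nnegrE ?normr_ge0// ltW//.
Qed.

(** Here [exp (c t) >= c t] already forces [|s t - se| < e] once
    [t > U (s 0) / (c a e^2)]. *)
Lemma lyapunov_attractive s : solution F s -> s t @[t --> +oo] --> se.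
Proof.
move=> hs; apply/cvgrPdist_lt => e e0.
have K0 : 0 < c * a * e ^+ 2 by rewrite !mulr_gt0// exprn_gt0.
near=> t.
have t0 : 0 <= t by near: t; apply: nbhs_pinfty_ge; exact: num_real.
have tU : U (s 0) / (c * a * e ^+ 2) < t.
  by near: t; apply: nbhs_pinfty_gt; exact: num_real.
rewrite distrC ltNge; apply/negP => le.
have dec := lyapunov_exp_decay hs t0.
have e1 := expR_ge1Dx (c * t).
have lo := U_lower (s t).
move: tU; rewrite ltr_pdivrMr// ltNge => /negP; apply.
have e2 : e ^+ 2 <= `|s t - se| ^+ 2.
  by rewrite ler_pXn2r// ?nnegrE ?normr_ge0// ltW//.
apply: le_trans dec; apply: (@le_trans _ _ (expR (c * t) * (a * e ^+ 2))).
  have -> : t * (c * a * e ^+ 2) = (c * t) * (a * e ^+ 2) by ring.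
  rewrite ler_wpM2r//; first by rewrite mulr_ge0 ?(ltW a0)// exprn_ge0 ?(ltW e0).
  by apply: le_trans e1; rewrite lerDr.
rewrite ler_wpM2l ?expR_ge0//; apply: le_trans lo; rewrite ler_wpM2l// ltW//.
Unshelve. all: by end_near. Qed.

End Lyapunov.

(** * Strongly monotone games *)

Lemma sum_norm_sqr_le (R : realType) n (u : 'I_n -> R) :
  (\sum_i `|u i|) ^+ 2 <= n%:R * \sum_i u i ^+ 2.
Proof.
rewrite expr2 mulr_suml.
apply: (@le_trans _ _ (\sum_i \sum_j (u i ^+ 2 + u j ^+ 2) / 2)).
  apply: ler_sum => i _; rewrite mulr_sumr; apply: ler_sum => j _.
  rewrite -[u i ^+ 2]real_normK ?num_real// -[u j ^+ 2]real_normK ?num_real//.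
  by have := sqr_ge0 (`|u i| - `|u j|); rewrite !expr2; lra.
under eq_bigr => i _ do rewrite -mulr_suml big_split/= sumr_const card_ord.
rewrite -mulr_suml big_split/= sumr_const card_ord -sumrMnl.
by under eq_bigr do rewrite -mulr_natl; rewrite -!mulr_sumr -mulr_natl; lra.
Qed.

Section Lines.
Variables (R : realType) (n : nat).
Implicit Types (g : 'rV[R]_n -> R) (x v : 'rV[R]_n).

Lemma is_derive_line g x v (t : R) : derivable g (x + t *: v) v ->
  is_derive t (1 : R) (fun h => g (x + h *: v)) ('D_v g (x + t *: v)).
Proof.
move=> dg.
have E : (fun h : R => h^-1 *: (g (x + (h *: 1 + t) *: v) - g (x + t *: v))) =
         (fun h : R => h^-1 *: ((g \o shift (x + t *: v)) (h *: v) - g (x + t *: v))).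
  apply/funext => h; congr (_ *: (g _ - _)).
  by rewrite /= scalerDl [h *: 1]mulr1 addrCA.
by apply: DeriveDef; rewrite /derivable /derive /= E.
Qed.

(** The intermediate point is at [h] between 0 and [t]; what strong monotonicity
    will exploit is that [h] and [t] have the same sign. *)
Lemma mean_value_line g x v (t : R) : (forall y, derivable g y v) ->
  exists2 h : R, 0 <= h * t &
    g (x + t *: v) - g x = t * 'D_v g (x + h *: v).
Proof.
move=> dg; pose phi (h : R) := g (x + h *: v).
have dphi h : is_derive h (1 : R) phi ('D_v g (x + h *: v)) by exact: is_derive_line.
have cphi (A : interval R) : {within [set` A], continuous phi}.
  by apply: derivable_within_continuous => h _; have := dphi h.
have E : g x = phi 0 by rewrite /phi scale0r addr0.
rewrite E -/(phi t); have [t0|t0] := leP 0 t.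
  have [h] := MVT_segment t0 (fun h _ => dphi h) (cphi _).
  rewrite in_itv/= => /andP[h0 ht] ->; exists h.
    by rewrite mulr_ge0.
  by rewrite subr0 mulrC.
have [h] := MVT_segment (ltW t0) (fun h _ => dphi h) (cphi _).
rewrite in_itv/= => /andP[th h0] e; exists h.
  by rewrite mulr_le0// ltW.
by rewrite -opprB e sub0r mulrN opprK mulrC.
Qed.

(** Go from [y] to [x] by changing one coordinate at a time; each move is along
    a coordinate axis, where the mean value theorem applies. *)
Lemma lipschitz_of_bounded_partials g (M : R) :
  (forall j y, derivable g y (delta_mx 0 j)) ->
  (forall j y, `|partial j g y| <= M) ->
  forall x y, `|g x - g y| <= M * \sum_j `|x 0 j - y 0 j|.
Proof.
move=> dg gM x y.
pose z k : 'rV[R]_n := \row_j (if (j < k)%N then x 0 j else y 0 j).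
have z0 : z 0%N = y by apply/rowP => j; rewrite mxE.
have zn : z n = x by apply/rowP => j; rewrite mxE ltn_ord.
have zS (k : 'I_n) : z k.+1 = z k + (x 0 k - y 0 k) *: delta_mx 0 k.
  apply/rowP => j; rewrite !mxE eqxx /= ltnS leq_eqVlt -(inj_eq val_inj) /=.
  case: (ltngtP j k) => [jk|jk|/val_inj ->]; rewrite ?mulr0 ?addr0//.
  by rewrite mulr1 addrC subrK.
have -> : g x - g y = \sum_(0 <= k < n) (g (z k.+1) - g (z k)).
  by rewrite (telescope_sumr (fun k => g (z k))) ?zn ?z0.
rewrite big_mkord mulr_sumr.
apply: le_trans (ler_norm_sum _ _ _) _; apply: ler_sum => k _; rewrite zS.
have [h _ ->] := mean_value_line (z k) (x 0 k - y 0 k) (dg k).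
by rewrite normrM mulrC ler_wpM2r//; exact: gM.
Qed.

End Lines.

Section Game.
Variables (R : realType) (n : nat) (f : 'I_n -> 'rV[R]_n -> R).
Hypothesis hf : forall i, class_C 2 (f i).

Let P := pseudo_gradient f.

Let f_derivable i y : derivable (f i) y (delta_mx 0 i).
Proof. by have [_ /(_ i) [d _]] := hf i; exact: d. Qed.

Lemma update_line (x : 'rV[R]_n) i t :
  update x i t = x + (t - x 0 i) *: delta_mx 0 i.
Proof.
apply/rowP => j; rewrite !mxE eqxx /=; case: eqP => [->|_].
  by rewrite mulr1 addrC subrK.
by rewrite mulr0 addr0.
Qed.

(** First-order condition for the minimum in the player's own action. *)
Lemma nash_pseudo_gradient0 x : nash_equilibrium f x -> P x = 0.
Proof.
move=> nx; apply/rowP => i; rewrite !mxE.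
pose phi (h : R) := f i (x + h *: delta_mx 0 i).
have dphi h : is_derive h (1 : R) phi (partial i (f i) (x + h *: delta_mx 0 i)).
  exact: is_derive_line.
have [_] : is_derive (0 : R) (1 : R) phi 0.
  have le11 : (-1 : R) <= 1 by lra.
  have in0 : (0 : R) \in `]-1, 1[%R by rewrite in_itv/= ltrN10 ltr01.
  have d t : t \in `]-1, 1[%R -> derivable phi t 1 by have := dphi t.
  apply: (derive1_at_min le11 d in0) => t _.
  have := nx i (x 0 i + t); rewrite update_line /phi scale0r addr0.
  by rewrite addrAC subrr add0r.
by have [_ ->] := dphi 0; rewrite scale0r addr0.
Qed.

Variable M : R.
Hypothesis hM : forall x i j, `|game_hessian f x i j| <= M.

Lemma pseudo_gradient_lipschitz i x y :
  `|P x 0 i - P y 0 i| <= M * \sum_j `|x 0 j - y 0 j|.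
Proof.
rewrite !mxE; apply: lipschitz_of_bounded_partials => j z.
  by have [_ /(_ i) [_ [_ /(_ j) [d _]]]] := hf i; exact: d.
by have := hM z i j; rewrite mxE.
Qed.

Lemma pseudo_gradient_lipschitz_sqr i x y :
  (P x 0 i - P y 0 i) ^+ 2 <= M ^+ 2 * n%:R * \sum_j (x 0 j - y 0 j) ^+ 2.
Proof.
rewrite -real_normK ?num_real// -mulrA.
apply: le_trans (ler_wpM2l (sqr_ge0 M) (sum_norm_sqr_le _)).
rewrite -exprMn ler_sqr ?nnegrE//; first exact: pseudo_gradient_lipschitz.
by apply: le_trans (pseudo_gradient_lipschitz i x y).
Qed.

Variable m : R.
Hypotheses (m0 : 0 < m) (mono : strongly_monotone P m).

(** Strong monotonicity, applied to two points that differ in the [i]-th action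
    only, says that the derivative of [f i] in that action increases, so a zero
    of it is a minimum.  In the proof, [h] and the displacement have the same
    sign, and [h * D >= m h^2] where [D] is the derivative at the intermediate
    point. *)
Lemma pseudo_gradient0_nash x : P x = 0 -> nash_equilibrium f x.
Proof.
move=> Px i t; rewrite update_line -subr_ge0.
have [h ht ->] := mean_value_line x (t - x 0 i) (@f_derivable i).
set w := x + h *: delta_mx 0 i.
have wE j : w 0 j - x 0 j = h * (j == i)%:R.
  by rewrite !mxE addrAC subrr add0r eqxx.
have := mono w x; under eq_bigr do rewrite wE exprMn.
under [X in _ <= X]eq_bigr do rewrite wE.
have one (u : 'I_n -> R) : \sum_j u j * (j == i)%:R = u i.
  rewrite (bigD1 i)//= eqxx mulr1 big1 ?addr0// => j /negPf ->.
  by rewrite mulr0.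
have -> : \sum_j h ^+ 2 * (j == i)%:R ^+ 2 = h ^+ 2.
  under eq_bigr do rewrite -natrX exprnP; rewrite -[RHS](one (fun=> h ^+ 2)).
  by apply: eq_bigr => j _; case: eqP.
have -> : \sum_j h * (j == i)%:R * (P w 0 j - P x 0 j) = h * P w 0 i.
  under eq_bigr do rewrite mulrAC; rewrite one Px; congr (_ * _).
  by rewrite [X in _ - X]mxE subr0.
have -> : P w 0 i = 'D_(delta_mx 0 i) (f i) w by rewrite mxE.
set D : R := 'D_ _ _ _ => hD.
have [h0|h0] := eqVneq h 0.
  suff -> : D = 0 by rewrite mulr0.
  rewrite /D /w h0 scale0r addr0.
  by have := congr1 (fun v : 'rV_n => v 0 i) Px; rewrite !mxE.
have h2 : 0 < h ^+ 2 by rewrite exprn_even_gt0.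
rewrite -(pmulr_rge0 _ h2) [leRHS](_ : _ = (h * (t - x 0 i)) * (h * D)); last by ring.
rewrite mulr_ge0//; apply: le_trans hD; rewrite mulr_ge0// ltW//.
Qed.
Lemma pseudo_gradient_inj x y : P x = 0 -> P y = 0 -> x = y.
Proof.
move=> Px Py; have := mono x y; rewrite Px Py.
rewrite [leRHS]big1 => [|i _]; last by rewrite subrr mulr0.
rewrite pmulr_rle0// => h; apply/rowP => i; apply/eqP; rewrite -subr_eq0 -sqrf_eq0.
have /psumr_eq0P e : forall j, true -> 0 <= (x 0 j - y 0 j) ^+ 2.
  by move=> *; exact: sqr_ge0.
by rewrite e//; apply/eqP; rewrite eq_le h sumr_ge0// => j _; exact: sqr_ge0.
Qed.

(** Expanding the square gives the factor [1 - 2 gamma m + gamma^2 n l], where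
    [n l] is a squared Lipschitz constant of the pseudo-gradient.  With
    [gamma = m / L] and [L >= n l] it is at most [1 - m^2 / L]; the summand
    [m^2] of [L] makes this nonnegative and less than 1. *)
Lemma gradient_step_contraction : exists gamma q : R,
  [/\ 0 < gamma, 0 <= q, q < 1 & forall x y,
    \sum_i ((x - gamma *: P x) 0 i - (y - gamma *: P y) 0 i) ^+ 2 <=
    q * \sum_i (x 0 i - y 0 i) ^+ 2].
Proof.
pose l := M ^+ 2 * n%:R; pose L := n%:R * l + m ^+ 2.
have l0 : 0 <= l by rewrite mulr_ge0 ?sqr_ge0.
have m2 : 0 < m ^+ 2 by rewrite exprn_gt0.
have nl0 : 0 <= n%:R * l by rewrite mulr_ge0.
have L0 : 0 < L by rewrite ltr_wpDl.
have mL : m ^+ 2 / L <= 1 by rewrite ler_pdivrMr// mul1r lerDr.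
exists (m / L), (1 - m ^+ 2 / L); split.
- by rewrite divr_gt0.
- by rewrite subr_ge0.
- by rewrite ltrBlDr ltrDl divr_gt0.
move=> x y; set g := m / L; set d := \sum_i (x 0 i - y 0 i) ^+ 2.
have dP : \sum_i (P x 0 i - P y 0 i) ^+ 2 <= n%:R * l * d.
  apply: le_trans (ler_sum _ (fun i _ => pseudo_gradient_lipschitz_sqr i x y)) _.
  by rewrite sumr_const card_ord -[leLHS]mulr_natl -[leRHS]mulrA.
have stepE u i : (u - g *: P u) 0 i = u 0 i - g * P u 0 i.
  by rewrite mxE; congr (_ + _); rewrite mxE; congr (- _); rewrite mxE.
have -> : \sum_i ((x - g *: P x) 0 i - (y - g *: P y) 0 i) ^+ 2 =
    d - (2 * g) * (\sum_i (x 0 i - y 0 i) * (P x 0 i - P y 0 i))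
      + g ^+ 2 * (\sum_i (P x 0 i - P y 0 i) ^+ 2).
  rewrite !mulr_sumr -sumrB -big_split/=; apply: eq_bigr => i _.
  rewrite !stepE; ring.
have d0 : 0 <= d by apply: sumr_ge0 => i _; exact: sqr_ge0.
have g0 : 0 < g by rewrite divr_gt0.
have h1 := ler_wpM2l (ltW (mulr_gt0 (ltr0Sn R 1) g0)) (mono x y).
have h2 := ler_wpM2l (sqr_ge0 g) dP.
have e1 : m ^+ 2 / L * d = g * (m * d) by rewrite /g; field; rewrite gt_eqF.
have e2 : g ^+ 2 * (n%:R * l * d) <= g * (m * d).
  rewrite (_ : g * (m * d) = g ^+ 2 * (L * d)); last by rewrite /g; field; rewrite gt_eqF.
  by rewrite ler_wpM2l ?sqr_ge0// ler_wpM2r// lerDl ltW.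
rewrite mulrBl mul1r e1; rewrite -/d in h1.
by move: h1 h2 e2; rewrite -!mulrA; lra.
Qed.

(** The contraction is for the Euclidean norm whereas completeness is used
    coordinate by coordinate, hence the ratio [sqrt q] for each coordinate. *)
Lemma exists_pseudo_gradient0 : exists x, P x = 0.
Proof.
have [g [q [g0 q0 q1 ctr]]] := gradient_step_contraction.
pose T x := x - g *: P x; pose x k := iter k T 0.
pose D := \sum_i (x 1%N 0 i - x 0%N 0 i) ^+ 2; pose r := Num.sqrt q.
have D0 : 0 <= D by apply: sumr_ge0 => i _; exact: sqr_ge0.
have dist k : \sum_i (x k.+1 0 i - x k 0 i) ^+ 2 <= D * q ^+ k.
  elim: k => [|k IH]; first by rewrite expr0 mulr1.
  by apply: le_trans (ctr _ _) _; rewrite exprS mulrCA ler_wpM2l.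
have r0 : 0 <= r by exact: sqrtr_ge0.
have r1 : r < 1 by rewrite -sqrtr1 ltr_sqrt.
have step i k : `|x k.+1 0 i - x k 0 i| <= Num.sqrt D * r ^+ k.
  rewrite -ler_sqr ?nnegrE ?mulr_ge0 ?exprn_ge0 ?sqrtr_ge0//.
  rewrite exprMn sqr_sqrtr// -exprM mulnC exprM sqr_sqrtr// real_normK ?num_real//.
  apply: le_trans (dist k); rewrite (bigD1 i)//= lerDl.
  by apply: sumr_ge0 => j _; exact: sqr_ge0.
have lim i := geometric_cauchy r0 r1 (step i).
pose l := projT1 (choice lim); have hl := projT2 (choice lim); rewrite -/l in hl.
pose p : 'rV[R]_n := \row_i l i; exists p.
pose C := Num.sqrt D / (1 - r).
apply/rowP => i; rewrite [RHS]mxE.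
apply: (@geometric_bound_eq0 _ _ (M * (n%:R * C) + Num.sqrt D / g) r) => // k.
rewrite -[P p 0 i](subrK (P (x k) 0 i)) mulrDl.
apply: le_trans (ler_normD _ _) _; apply: lerD.
  apply: le_trans (pseudo_gradient_lipschitz _ _ _) _.
  have M0 : 0 <= M by apply: le_trans (hM p i i).
  rewrite -mulrA ler_wpM2l// -mulrA mulr_natl.
  rewrite -[X in _ *+ X]card_ord -sumr_const; apply: ler_sum => j _.
  by rewrite mxE; exact: hl.
have := step i k; have -> : x k.+1 0 i - x k 0 i = - (g * P (x k) 0 i).
  by rewrite /x iterS -/(x k) /T 3!mxE addrAC subrr add0r.
by rewrite normrN normrM (gtr0_norm g0) mulrAC ler_pdivlMr// mulrC.
Qed.

Lemma exists_unique_nash :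
  exists2 x, P x = 0 & unique (nash_equilibrium f) x.
Proof.
have [x Px] := exists_pseudo_gradient0; exists x => //; split.
  exact: pseudo_gradient0_nash.
by move=> y /nash_pseudo_gradient0; exact: pseudo_gradient_inj.
Qed.

End Game.

(** * Grounded graph Laplacians *)

Section Graph.
Variables (R : realType) (n : nat) (e : rel 'I_n).
Hypotheses (n2 : (2 <= n)%N) (he : simple_graph e) (hconn : connected_graph e).

Let a : 'M[R]_n := adjacency R e.

(** Quadratic form of the graph Laplacian grounded at the neighbours of [j]:
    player [j]'s action is known exactly to them, and is diffused over the edges
    to the others. *)
Definition grounded_energy (j : 'I_n) (u : 'I_n -> R) : R :=
  \sum_i a i j * u i ^+ 2 + 2^-1 * \sum_i \sum_k a i k * (u i - u k) ^+ 2.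

Let a_ge0 i k : 0 <= a i k.
Proof. by rewrite mxE ler0n. Qed.

Let aC i k : a i k = a k i.
Proof. by case: he => sym _; rewrite !mxE sym. Qed.

Lemma grounded_laplacian_energy j (u : 'I_n -> R) :
  \sum_i u i * (\sum_k a i k * (u i - u k) + a i j * u i) = grounded_energy j u.
Proof.
rewrite /grounded_energy.
under eq_bigr => i _ do rewrite mulrDr mulrCA -expr2.
rewrite big_split/= addrC; congr (_ + _).
have E : \sum_i u i * (\sum_k a i k * (u i - u k)) =
         \sum_i \sum_k a i k * (u i * (u i - u k)).
  by apply: eq_bigr => i _; rewrite mulr_sumr; apply: eq_bigr => k _; ring.
have E' : \sum_i u i * (\sum_k a i k * (u i - u k)) =
         \sum_i \sum_k a i k * (u k * (u k - u i)).
  rewrite E exchange_big; apply: eq_bigr => i _; apply: eq_bigr => k _.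
  by rewrite aC.
apply: (@mulfI _ 2) => //; rewrite mulrA divff// mul1r mulr_natl mulr2n.
rewrite {1}E E' -big_split; apply: eq_bigr => i _; rewrite -big_split.
by apply: eq_bigr => k _ /=; ring.
Qed.

Let neighbour j : exists p, e p j.
Proof.
case: he => sym irr.
have [i ij] : exists i : 'I_n, i != j.
  pose i0 := Ordinal (ltnW n2); pose i1 := Ordinal n2.
  by have [<-|?] := eqVneq i0 j; [exists i1 | exists i0].
have /connectP [[|p s]] := hconn j i; first by move=> _ ij'; rewrite ij' eqxx in ij.
by move=> /= /andP[jp _] _; exists p; rewrite sym.
Qed.

Let energy_ge_ground j p u : e p j -> u p ^+ 2 <= grounded_energy j u.
Proof.
move=> pj; rewrite /grounded_energy (bigD1 p)//= mxE pj mul1r -addrA lerDl.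
apply: addr_ge0; first by apply: sumr_ge0 => i _; rewrite mulr_ge0 ?sqr_ge0.
rewrite mulr_ge0 ?invr_ge0//; apply: sumr_ge0 => i _; apply: sumr_ge0 => k _.
by rewrite mulr_ge0 ?sqr_ge0.
Qed.

Let energy_ge_edge j i k u : e i k -> (u k - u i) ^+ 2 <= 2 * grounded_energy j u.
Proof.
move=> ik; rewrite /grounded_energy mulrDr mulrA divff// mul1r.
have h1 : 0 <= \sum_i a i j * u i ^+ 2.
  by apply: sumr_ge0 => l _; rewrite mulr_ge0 ?sqr_ge0.
have h2 : (u k - u i) ^+ 2 <= \sum_i \sum_k a i k * (u i - u k) ^+ 2.
  rewrite (bigD1 i)//= (bigD1 k)//= [a i k]mxE ik mul1r -sqrrN opprB -addrA lerDl.
  apply: addr_ge0; first by apply: sumr_ge0 => l _; rewrite mulr_ge0 ?sqr_ge0.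
  apply: sumr_ge0 => l _; apply: sumr_ge0 => l' _.
  by rewrite mulr_ge0 ?sqr_ge0.
by apply: le_trans h2 _; rewrite lerDr mulr_ge0.
Qed.

(** A neighbour of [j] is controlled directly, and the bound propagates along a
    path since [u_k^2 <= 2 u_p^2 + 2 (u_k - u_p)^2]. *)
Let vertex_le_energy j i : exists2 C : R, 0 < C &
  forall u, u i ^+ 2 <= C * grounded_energy j u.
Proof.
have [p pj] := neighbour j; have /connectP [s ps ->] := hconn p i.
have : exists2 C : R, 0 < C & forall u, u p ^+ 2 <= C * grounded_energy j u.
  by exists 1 => // u; rewrite mul1r energy_ge_ground.
elim: s p {pj} ps => //= k s IH p /andP[pk ks] [C C0 hC].
apply: IH ks _; exists (2 * C + 4) => [|u]; first by rewrite addr_gt0 ?mulr_gt0.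
have := hC u; have := energy_ge_edge j u pk; have := sqr_ge0 (u k - 2 * u p).
by rewrite !expr2; nra.
Qed.

(** The connectedness of the graph enters through [vertex_le_energy], and with two
    vertices it provides [j] with a neighbour.  The constant serves all [j] at
    once because there are finitely many of them. *)
Lemma grounded_laplacian_coercive : exists2 lam : R, 0 < lam &
  forall j (u : 'I_n -> R), lam * \sum_i u i ^+ 2 <=
    \sum_i u i * (\sum_k a i k * (u i - u k) + a i j * u i).
Proof.
have bound (ji : 'I_n * 'I_n) : exists C : R, 0 < C /\
    forall u, u ji.2 ^+ 2 <= C * grounded_energy ji.1 u.
  by have [C C0 hC] := vertex_le_energy ji.1 ji.2; exists C.
pose C := projT1 (choice bound); have hC := projT2 (choice bound).
rewrite -/C in hC.
have C0 j i : 0 < C (j, i) by case: (hC (j, i)).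
pose B := 1 + \sum_j \sum_i C (j, i).
have B0 : 0 < B.
  by rewrite ltr_wpDr// sumr_ge0// => j _; rewrite sumr_ge0// => i _; exact/ltW.
exists B^-1 => [|j u]; first by rewrite invr_gt0.
rewrite grounded_laplacian_energy mulrC ler_pdivrMr// mulrC.
have E0 : 0 <= grounded_energy j u.
  by have [p pj] := neighbour j; apply: le_trans (energy_ge_ground u pj); exact: sqr_ge0.
apply: (@le_trans _ _ (\sum_i C (j, i) * grounded_energy j u)).
  by apply: ler_sum => i _; case: (hC (j, i)) => _; apply.
rewrite -mulr_suml ler_wpM2r//; apply: ler_wpDl => //.
rewrite [leRHS](bigD1 j)//= lerDl sumr_ge0// => k _; rewrite sumr_ge0// => i _; exact/ltW.
Qed.

End Graph.

(** * The seeking dynamics *)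

Section StateCoordinates.
Variables (R : realType) (n : nat).

Definition state_index : finType := ('I_n + 'I_n + 'I_n + 'I_n * 'I_n)%type.

Definition state_coord (i : state_index) (s : state R n) : R :=
  match i with
  | inl (inl (inl k)) => s.1.1.1 0 k
  | inl (inl (inr k)) => s.1.1.2 0 k
  | inl (inr k) => s.1.2 0 k
  | inr (k, l) => s.2 k l
  end.

Definition state_of_coord (w : state_index -> R) : state R n :=
  (\row_k w (inl (inl (inl k))), \row_k w (inl (inl (inr k))),
   \row_k w (inl (inr k)), \matrix_(k, l) w (inr (k, l))).

Lemma mx_norm_le p q (A : 'M[R]_(p, q)) (b : R) : 0 <= b ->
  `|A| <= b <-> forall i j, `|A i j| <= b.
Proof.
move=> b0; rewrite [`|A|]mx_normrE; split=> [le i j|le].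
  by apply: le_trans le; exact: (le_bigmax _ (fun ij => `|A ij.1 ij.2|) (i, j)).
by apply: bigmax_le => // -[i j] _; exact: le.
Qed.

Lemma state_sup_coordinates : sup_coordinates state_coord state_of_coord.
Proof.
split.
- by move=> [[[k|k]|k]|[k l]] a u v; rewrite /= !mxE.
- move=> [[[x nu] z] y] b b0.
  rewrite !prod_normE /= !ge_max; split.
    move=> /andP[/andP[/andP[hx hnu] hz] hy] [[[k|k]|k]|[k l]] /=;
      by [apply/(mx_norm_le _ b0).1 : 0 k | apply/(mx_norm_le _ b0).1 : k l].
  move=> h; apply/andP; split; [apply/andP; split; [apply/andP; split|]|];
    apply/(mx_norm_le _ b0) => i j; rewrite ?(ord1 i).
  + exact: (h (inl (inl (inl j)))).
  + exact: (h (inl (inl (inr j)))).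
  + exact: (h (inl (inr j))).
  + exact: (h (inr (i, j))).
- by move=> w [[[k|k]|k]|[k l]]; rewrite /= mxE.
Qed.

End StateCoordinates.

Section LipschitzFunctionals.
Variables (R : realType) (V : normedModType R).

Definition lipschitz_functional (g : V -> R) :=
  exists2 L : R, 0 <= L & forall u v, `|g u - g v| <= L * `|u - v|.

Lemma lipschitz_functionalD g h : lipschitz_functional g ->
  lipschitz_functional h -> lipschitz_functional (fun v => g v + h v).
Proof.
move=> [L L0 hL] [M M0 hM]; exists (L + M) => [|u v]; first exact: addr_ge0.
rewrite opprD addrACA mulrDl; apply: le_trans (ler_normD _ _) _.
by apply: lerD; [exact: hL | exact: hM].
Qed.

Lemma lipschitz_functionalZ a g : lipschitz_functional g ->
  lipschitz_functional (fun v => a * g v).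
Proof.
move=> [L L0 hL]; exists (`|a| * L) => [|u v]; first exact: mulr_ge0.
by rewrite -mulrBr normrM -mulrA ler_wpM2l.
Qed.

Lemma lipschitz_functionalN g : lipschitz_functional g ->
  lipschitz_functional (fun v => - g v).
Proof.
move=> /(lipschitz_functionalZ (-1)) [L L0 hL]; exists L => // u v.
by have := hL u v; rewrite !mulN1r.
Qed.

Lemma lipschitz_functional_sum (I : finType) (g : I -> V -> R) :
  (forall i, lipschitz_functional (g i)) ->
  lipschitz_functional (fun v => \sum_i g i v).
Proof.
move=> hg; have hg' i : exists L, 0 <= L /\ forall u v, `|g i u - g i v| <= L * `|u - v|.
  by have [L L0 hL] := hg i; exists L.
pose L := projT1 (choice hg'); have hL := projT2 (choice hg'); rewrite -/L in hL.
exists (\sum_i L i) => [|u v]; first by apply: sumr_ge0 => i _; case: (hL i).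
rewrite -sumrB mulr_suml; apply: le_trans (ler_norm_sum _ _ _) _.
by apply: ler_sum => i _; case: (hL i).
Qed.

Lemma lipschitz_of_coord (I : finType) (c : I -> V -> R) mk (F : V -> V) :
  sup_coordinates c mk -> (forall i, lipschitz_functional (fun v => c i (F v))) ->
  exists2 L : R, 0 < L & forall u v, `|F u - F v| <= L * `|u - v|.
Proof.
move=> hc hF.
have hF' i : exists L, 0 <= L /\ forall u v, `|c i (F u) - c i (F v)| <= L * `|u - v|.
  by have [L L0 hL] := hF i; exists L.
pose L := projT1 (choice hF'); have hL := projT2 (choice hF'); rewrite -/L in hL.
have S0 : 0 <= \sum_i L i by apply: sumr_ge0 => i _; case: (hL i).
exists (1 + \sum_i L i) => [|u v]; first by rewrite ltr_wpDr.
apply: (norm_le_coord hc) => [|i]; first by rewrite mulr_ge0// addr_ge0.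
rewrite (coordB hc); case: (hL i) => _ /(_ u v) /le_trans; apply.
rewrite ler_wpM2r// ler_wpDl// (bigD1 i)//= lerDl sumr_ge0// => j _.
by case: (hL j).
Qed.

End LipschitzFunctionals.

Section SeekingField.
Variables (R : realType) (n : nat) (f : 'I_n -> 'rV[R]_n -> R).
Variables (a : 'M[R]_n) (Kb : 'I_n -> R) (th : 'I_n -> 'I_n -> R).

Let F := seeking_dynamics f a Kb th.

Lemma seeking_dynamics_equilibrium x : pseudo_gradient f x = 0 ->
  F (seeking_equilibrium x) = 0.
Proof.
move=> Px; have rE i : row i (\matrix_(k < n, j < n) x 0 j) = x.
  by apply/rowP => j; rewrite !mxE.
have pE i : partial i (f i) x = 0.
  by have := congr1 (fun v : 'rV_n => v 0 i) Px; rewrite !mxE.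
rewrite /F /seeking_equilibrium /=; congr (_, _, _, _).
- by apply/rowP => i; rewrite !mxE rE pE mulr0 !subrr oppr0 addr0.
- by apply/rowP => i; rewrite !mxE rE pE mulr0.
- apply/matrixP => i j; rewrite !mxE subrr mulr0 addr0 big1 ?mulr0// => k _.
  by rewrite !mxE subrr mulr0.
Qed.

Hypothesis hP : exists M : R, forall i x y,
  `|pseudo_gradient f x 0 i - pseudo_gradient f y 0 i| <= M * \sum_j `|x 0 j - y 0 j|.

(** The only nonlinear ingredient of the field is the pseudo-gradient, which is
    globally Lipschitz by assumption. *)
Lemma seeking_dynamics_lipschitz :
  exists2 L : R, 0 < L & forall u v, `|F u - F v| <= L * `|u - v|.
Proof.
have hc := state_sup_coordinates R n.
apply: (lipschitz_of_coord hc).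
have lc i : lipschitz_functional (@state_coord R n i).
  by exists 1 => // u v; rewrite mul1r -(coordB hc) (coord_norm_le hc).
have lg i : lipschitz_functional (fun s : state R n => partial i (f i) (row i s.2)).
  have [M hM] := hP; exists (`|M| * n%:R) => [|u v]; first exact: mulr_ge0.
  have := hM i (row i u.2) (row i v.2); rewrite ![pseudo_gradient _ _ _ _]mxE.
  move=> /le_trans; apply; apply: (@le_trans _ _ (`|M| * \sum_j `|u.2 i j - v.2 i j|)).
    under eq_bigr do rewrite !mxE; rewrite ler_wpM2r ?ler_norm//.
    by apply: sumr_ge0.
  rewrite -mulrA ler_wpM2l// mulr_natl -[X in _ *+ X]card_ord -sumr_const.
  apply: ler_sum => j _; rewrite -[u.2 i j]/(state_coord (inr (i, j)) u).
  rewrite -[v.2 i j]/(state_coord (inr (i, j)) v) -(coordB hc).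
  exact: coord_norm_le hc _ _.
have lx i : lipschitz_functional (fun s : state R n => s.1.1.1 0 i) :=
  lc (inl (inl (inl i))).
have ln i : lipschitz_functional (fun s : state R n => s.1.1.2 0 i) :=
  lc (inl (inl (inr i))).
have lz i : lipschitz_functional (fun s : state R n => s.1.2 0 i) := lc (inl (inr i)).
have ly i j : lipschitz_functional (fun s : state R n => s.2 i j) := lc (inr (i, j)).
have lzd i := lipschitz_functionalZ (- Kb i) (lg i).
move=> [[[k|k]|k]|[k l]].
- rewrite (_ : (fun _ => _) = (fun s : state R n => s.1.1.2 0 k))//.
  by apply/funext => -[[[x nu] z] y].
- rewrite (_ : (fun _ => _) = (fun s : state R n => - (s.1.1.1 0 k - s.1.2 0 k)
     - (s.1.1.2 0 k - - Kb k * partial k (f k) (row k s.2)))).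
    apply: lipschitz_functionalD; apply: lipschitz_functionalN;
    by apply: lipschitz_functionalD => //; apply: lipschitz_functionalN.
  by apply/funext => -[[[x nu] z] y]; rewrite /= !mxE.
- rewrite (_ : (fun _ => _) = (fun s : state R n => - Kb k * partial k (f k) (row k s.2)))//.
  by apply/funext => -[[[x nu] z] y]; rewrite /= !mxE.
- rewrite (_ : (fun _ => _) = (fun s : state R n => - th k l *
     (\sum_i a k i * (s.2 k l - s.2 i l) + a k l * (s.2 k l - s.1.2 0 l)))).
    apply: lipschitz_functionalZ; apply: lipschitz_functionalD.
      apply: lipschitz_functional_sum => i; apply: lipschitz_functionalZ.
      by apply: lipschitz_functionalD => //; apply: lipschitz_functionalN.
    apply: lipschitz_functionalZ; apply: lipschitz_functionalD => //.
    exact: lipschitz_functionalN.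
  by apply/funext => -[[[x nu] z] y]; rewrite /= !mxE.
Qed.

End SeekingField.

(** * The energy and its decay *)

Section Energy.
Variables (R : realType) (n : nat).
Variables (K : 'I_n -> R) (tb : 'I_n -> 'I_n -> R) (xs : 'rV[R]_n) (mu : R).
Implicit Types s w : state R n.

Definition z_error s i : R := s.1.2 0 i - xs 0 i.
Definition x_lag s i : R := s.1.1.1 0 i - s.1.2 0 i.
Definition velocity s i : R := s.1.1.2 0 i.
Definition y_lag s i j : R := s.2 i j - s.1.2 0 j.

(** The errors of [x] and [y] are measured from [z], not from the equilibrium,
    because [x] is driven towards [z] and the estimates [y_ij] towards [z_j].
    The weights [1 / K_i] and [1 / tb_ij] cancel the gains of the dynamics.  The
    damping acts on [velocity] only; the product [x_lag * velocity] makes the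
    mechanical part decay in [x_lag] too. *)
Definition energy s : R :=
  \sum_i ((2 * K i)^-1 * z_error s i ^+ 2 +
    mu * (x_lag s i ^+ 2 + velocity s i ^+ 2 + x_lag s i * velocity s i)) +
  \sum_i \sum_j (2 * tb i j)^-1 * y_lag s i j ^+ 2.

(** Derivative of [energy] at [s] in the direction [w]; [x_lag], [velocity] and
    [y_lag] are linear, so that they apply to [w] as well. *)
Definition energy_rate s w : R :=
  \sum_i ((K i)^-1 * (z_error s i * w.1.2 0 i) +
    mu * (2 * x_lag s i * x_lag w i + 2 * velocity s i * velocity w i
          + (x_lag s i * velocity w i + velocity s i * x_lag w i))) +
  \sum_i \sum_j (tb i j)^-1 * (y_lag s i j * y_lag w i j).

Lemma is_derive_sum_fun (p : nat) (h : 'I_p -> R -> R) (t : R) (dh : 'I_p -> R) :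
  (forall i, is_derive t (1 : R) (h i) (dh i)) ->
  is_derive t (1 : R) (fun x => \sum_i h i x) (\sum_i dh i).
Proof.
move=> hd; have := is_derive_sum hd; congr is_derive.
by apply/funext => x; rewrite fct_sumE.
Qed.

Lemma is_derive_energy (p : R -> state R n) (t : R) (w : state R n) :
  is_derive t 1 p w -> is_derive t (1 : R) (energy \o p) (energy_rate (p t) w).
Proof.
move=> pd; have hc := state_sup_coordinates R n.
have dc i := (is_derive_coord hc p t w).1 pd i.
have dx i : is_derive t (1 : R) (fun h => (p h).1.1.1 0 i) (w.1.1.1 0 i) :=
  dc (inl (inl (inl i))).
have dv i : is_derive t (1 : R) (fun h => velocity (p h) i) (velocity w i) :=
  dc (inl (inl (inr i))).
have dz i : is_derive t (1 : R) (fun h => (p h).1.2 0 i) (w.1.2 0 i) :=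
  dc (inl (inr i)).
have dy i j : is_derive t (1 : R) (fun h => (p h).2 i j) (w.2 i j) :=
  dc (inr (i, j)).
have de i : is_derive t (1 : R) (fun h => z_error (p h) i) (w.1.2 0 i).
  by have := is_deriveB (dz i) (is_derive_cst (xs 0 i) t 1); rewrite subr0.
have du i : is_derive t (1 : R) (fun h => x_lag (p h) i) (x_lag w i).
  exact: is_deriveB (dx i) (dz i).
have dl i j : is_derive t (1 : R) (fun h => y_lag (p h) i j) (y_lag w i j).
  exact: is_deriveB (dy i j) (dz j).
have sq (g : R -> R) dg : is_derive t (1 : R) g dg ->
    is_derive t (1 : R) (fun h => g h ^+ 2) (2 * g t * dg).
  move=> gd; apply: is_derive_eq (is_deriveX 2 gd) _.
  by rewrite /GRing.scale/= expr1.
have mul (g h : R -> R) dg dh : is_derive t (1 : R) g dg ->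
    is_derive t (1 : R) h dh ->
    is_derive t (1 : R) (fun x => g x * h x) (g t * dh + h t * dg).
  by move=> gd hd; apply: is_derive_eq (is_deriveM gd hd) _.
have scl k (g : R -> R) dg : is_derive t (1 : R) g dg ->
    is_derive t (1 : R) (fun h => k * g h) (k * dg).
  by move=> gd; apply: is_derive_eq (is_deriveZ k gd) _.
have half (k a b : R) : (2 * k)^-1 * (2 * a * b) = k^-1 * (a * b).
  by rewrite invfM -[2 * a * b]mulrA mulrACA mulVf// mul1r.
apply: is_deriveD; apply: is_derive_sum_fun => i.
  (* The derivative of the term in mu is found by instance search, from sq, mul,
     scl, du and dv. *)
  apply: is_deriveD.
    apply: is_derive_eq (scl _ _ _ (sq _ _ (de i))) _.
    exact: half.
apply: is_derive_sum_fun => j.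
by apply: is_derive_eq (scl _ _ _ (sq _ _ (dl i j))) _; exact: half.
Qed.

Lemma energy_continuous : continuous energy.
Proof.
move=> s; have hc := state_sup_coordinates R n.
have cc i : state_coord i v @[v --> s] --> state_coord i s.
  have /(cvg_coord hc) h : (fun v : state R n => v) v @[v --> s] --> s by exact: cvg_id.
  exact: h.
have cx i : (fun v : state R n => v.1.1.1 0 i) @ s --> s.1.1.1 0 i :=
  cc (inl (inl (inl i))).
have cv i : (fun v => velocity v i) @ s --> velocity s i := cc (inl (inl (inr i))).
have cz i : (fun v : state R n => v.1.2 0 i) @ s --> s.1.2 0 i := cc (inl (inr i)).
have cy i j : (fun v : state R n => v.2 i j) @ s --> s.2 i j := cc (inr (i, j)).
have csum (h : 'I_n -> state R n -> R) : (forall i, h i v @[v --> s] --> h i s) ->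
    \sum_i h i v @[v --> s] --> \sum_i h i s.
  by move=> hh; apply: cvg_big => [|i _]; [exact: add_continuous | exact: hh].
have sq (h : state R n -> R) : h v @[v --> s] --> h s ->
  h v ^+ 2 @[v --> s] --> h s ^+ 2 by move=> hh; apply: cvgM.
apply: cvgD; apply: (csum _) => i.
  apply: cvgD.
    apply: cvgMr; apply: sq; apply: cvgB; [exact: cz | exact: cvg_cst].
  have cu : x_lag v i @[v --> s] --> x_lag s i by apply: cvgB; [exact: cx|exact: cz].
  apply: cvgMr; apply: cvgD; first by apply: cvgD; exact: sq.
  by apply: cvgM.
apply: (csum (fun j v => (2 * tb i j)^-1 * y_lag v i j ^+ 2)) => j.
by apply: cvgMr; apply: sq; apply: cvgB; [exact: cy | exact: cz].
Qed.

(** A quadratic form comparable both to [energy] and to the squared distance to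
    the equilibrium, in which the decay estimate takes its simplest form. *)
Definition error_sqr s : R :=
  \sum_i (z_error s i ^+ 2 + (x_lag s i ^+ 2 + velocity s i ^+ 2)) +
  \sum_i \sum_j y_lag s i j ^+ 2.

Lemma error_sqr_ge0 s : 0 <= error_sqr s.
Proof.
apply: addr_ge0; apply: sumr_ge0 => i _; first by rewrite !addr_ge0 ?sqr_ge0.
by apply: sumr_ge0 => j _; exact: sqr_ge0.
Qed.

Hypotheses (K0 : forall i, 0 < K i) (tb0 : forall i j, 0 < tb i j) (mu0 : 0 < mu).

Lemma energy_error_bounds : exists a b : R, [/\ 0 < a, 0 < b &
  forall s, a * error_sqr s <= energy s /\ energy s <= b * error_sqr s].
Proof.
have K2 i : 0 < (2 * K i)^-1 by rewrite invr_gt0 mulr_gt0.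
have t2 (ij : 'I_n * 'I_n) : 0 < (2 * tb ij.1 ij.2)^-1 by rewrite invr_gt0 mulr_gt0.
have [k k0 hk] := finite_lower_bound K2.
have [k' k'0 hk'] := finite_upper_bound (fun i => (2 * K i)^-1).
have [t t0 ht] := finite_lower_bound t2.
have [t' t'0 ht'] := finite_upper_bound (fun ij : 'I_n * 'I_n => (2 * tb ij.1 ij.2)^-1).
pose a := Num.min k (Num.min (mu / 2) t).
have ak : a <= k by rewrite ge_min lexx.
have amu : a <= mu / 2 by rewrite !ge_min lexx orbT.
have at_ : a <= t by rewrite !ge_min lexx !orbT.
exists a, (k' + 2 * mu + t'); split => [||s].
- by rewrite !lt_min k0 t0 divr_gt0.
- by rewrite !addr_gt0// mulr_gt0.
rewrite /energy /error_sqr !mulrDr !mulr_sumr; split; apply: lerD; apply: ler_sum => i _.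
- rewrite mulrDr; apply: lerD.
    by rewrite ler_wpM2r ?sqr_ge0//; apply: le_trans ak (hk i).
  have := ler_wpM2r (addr_ge0 (sqr_ge0 (x_lag s i)) (sqr_ge0 (velocity s i))) amu.
  move=> /le_trans; apply; rewrite -mulrA ler_wpM2l ?(ltW mu0)//.
  by have := sqr_ge0 (x_lag s i + velocity s i); nra.
- rewrite mulr_sumr; apply: ler_sum => j _; rewrite ler_wpM2r ?sqr_ge0//.
  exact: le_trans at_ (ht (i, j)).
- rewrite [leRHS]mulrDr; apply: lerD.
    rewrite ler_wpM2r ?sqr_ge0//; apply: le_trans (hk' i) _.
    by have := mu0; lra.
  apply: (@le_trans _ _ (2 * mu * (x_lag s i ^+ 2 + velocity s i ^+ 2))).
    rewrite -mulrA mulrCA ler_wpM2l ?(ltW mu0)//.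
    by have := sqr_ge0 (x_lag s i - velocity s i); nra.
  by rewrite ler_wpM2r ?addr_ge0 ?sqr_ge0//; lra.
- rewrite mulr_sumr; apply: ler_sum => j _; rewrite ler_wpM2r ?sqr_ge0//.
  by apply: le_trans (ht' (i, j)) _; have := mu0; lra.
Qed.

Let se : state R n := seeking_equilibrium xs.

Lemma norm_le_error s : `|s - se| ^+ 2 <= 2 * error_sqr s.
Proof.
have hc := state_sup_coordinates R n.
have D0 : 0 <= 2 * error_sqr s by rewrite mulr_ge0 ?error_sqr_ge0.
rewrite -[leRHS]sqr_sqrtr// ler_sqr ?nnegrE ?sqrtr_ge0//.
apply: (norm_le_coord hc) (sqrtr_ge0 _) _ => k.
rewrite -ler_sqr ?nnegrE ?sqrtr_ge0// sqr_sqrtr// real_normK ?num_real//.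
rewrite (coordB hc).
have split_i i : z_error s i ^+ 2 + (x_lag s i ^+ 2 + velocity s i ^+ 2) +
    \sum_k \sum_j y_lag s k j ^+ 2 <= error_sqr s.
  rewrite lerD2r (bigD1 i)//= lerDl; apply: sumr_ge0 => j _.
  by rewrite !addr_ge0 ?sqr_ge0.
have y0 : 0 <= \sum_k \sum_j y_lag s k j ^+ 2.
  by apply: sumr_ge0 => i _; apply: sumr_ge0 => j _; exact: sqr_ge0.
case: k => [[[i|i]|i]|[i j]] /=; have := split_i i.
- have -> : s.1.1.1 0 i - xs 0 i = x_lag s i + z_error s i.
    by rewrite /x_lag /z_error; ring.
  have := sqr_ge0 (velocity s i); have := sqr_ge0 (x_lag s i - z_error s i); nra.
- rewrite !mxE subr0 -/(velocity s i).
  have := sqr_ge0 (x_lag s i); have := sqr_ge0 (z_error s i).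
  have := sqr_ge0 (velocity s i); lra.
- rewrite -/(z_error s i).
  have := sqr_ge0 (x_lag s i); have := sqr_ge0 (z_error s i).
  have := sqr_ge0 (velocity s i); lra.
- move=> _; have := split_i j.
  rewrite mxE; have -> : s.2 i j - xs 0 j = y_lag s i j + z_error s j.
    by rewrite /y_lag /z_error; ring.
  have : y_lag s i j ^+ 2 <= \sum_k \sum_j y_lag s k j ^+ 2.
    rewrite (bigD1 i)//= (bigD1 j)//= -addrA lerDl addr_ge0//.
      by apply: sumr_ge0 => l _; exact: sqr_ge0.
    by apply: sumr_ge0 => l _; apply: sumr_ge0 => l' _; exact: sqr_ge0.
  have := sqr_ge0 (x_lag s j); have := sqr_ge0 (velocity s j).
  have := sqr_ge0 (y_lag s i j - z_error s j); nra.
Qed.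

Lemma error_le_norm : exists2 b : R, 0 < b & forall s, error_sqr s <= b * `|s - se| ^+ 2.
Proof.
have hc := state_sup_coordinates R n.
exists (12 * n%:R + 4 * n%:R * n%:R + 1) => [|s].
  by rewrite ltr_wpDl// addr_ge0// !mulr_ge0.
set r := `|s - se|.
have cr k : `|state_coord k s - state_coord k se| <= r.
  by rewrite -(coordB hc) (coord_norm_le hc).
have hz i : `|z_error s i| <= r by have := cr (inl (inr i)).
have hv i : `|velocity s i| <= r.
  by have := cr (inl (inl (inr i))); rewrite /= !mxE subr0.
have hx i : `|s.1.1.1 0 i - xs 0 i| <= r by have := cr (inl (inl (inl i))).
have hy i j : `|s.2 i j - xs 0 j| <= r by have := cr (inr (i, j)); rewrite /= mxE.
have r0 : 0 <= r by exact: normr_ge0.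
have sq (q : R) : `|q| <= 2 * r -> q ^+ 2 <= 4 * r ^+ 2.
  move=> hq; rewrite -real_normK ?num_real//.
  rewrite [leRHS](_ : _ = (2 * r) ^+ 2); last by ring.
  by rewrite ler_sqr ?nnegrE// mulr_ge0.
have r2 (q : R) : `|q| <= r -> `|q| <= 2 * r by move=> /le_trans; apply; lra.
have hu i : x_lag s i ^+ 2 <= 4 * r ^+ 2.
  have -> : x_lag s i = (s.1.1.1 0 i - xs 0 i) - z_error s i.
    by rewrite /x_lag /z_error; ring.
  apply: sq; apply: le_trans (ler_normB _ _) _.
  by have := hx i; have := hz i; lra.
have hl i j : y_lag s i j ^+ 2 <= 4 * r ^+ 2.
  have -> : y_lag s i j = (s.2 i j - xs 0 j) - z_error s j.
    by rewrite /y_lag /z_error; ring.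
  apply: sq; apply: le_trans (ler_normB _ _) _.
  by have := hy i j; have := hz j; lra.
have h1 : \sum_i (z_error s i ^+ 2 + (x_lag s i ^+ 2 + velocity s i ^+ 2)) <=
    12 * n%:R * r ^+ 2.
  apply: (@le_trans _ _ (\sum_(i < n) (12 * r ^+ 2))).
    apply: ler_sum => i _; have := hu i.
    by have := sq _ (r2 _ (hz i)); have := sq _ (r2 _ (hv i)); lra.
  by rewrite sumr_const card_ord -[leLHS]mulr_natl; lra.
have h2 : \sum_i \sum_j y_lag s i j ^+ 2 <= 4 * n%:R * n%:R * r ^+ 2.
  apply: (@le_trans _ _ (\sum_(i < n) \sum_(j < n) (4 * r ^+ 2))).
    by apply: ler_sum => i _; apply: ler_sum => j _; exact: hl.
  rewrite !sumr_const card_ord -[leLHS]mulr_natl -[X in _ * X <= _]mulr_natl; lra.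
by rewrite /error_sqr; have := sqr_ge0 r; lra.
Qed.

End Energy.

Section Decay.
Variables (R : realType) (n : nat) (f : 'I_n -> 'rV[R]_n -> R) (e : rel 'I_n).
Variables (K : 'I_n -> R) (tb : 'I_n -> 'I_n -> R) (xs : 'rV[R]_n).
Hypotheses (K0 : forall i, 0 < K i) (tb0 : forall i j, 0 < tb i j).

Let a : 'M[R]_n := adjacency R e.
Let P := pseudo_gradient f.
Let field theta theta1 : state R n -> state R n :=
  seeking_dynamics f a (fun i => theta1 * K i) (fun i j => theta * theta1 * tb i j).

Let err := z_error xs.
Let grad (s : state R n) i : R := partial i (f i) (row i s.2).
Let diffusion (s : state R n) i j : R :=
  \sum_k a i k * (y_lag s i j - y_lag s k j) + a i j * y_lag s i j.

(** The gains [K] and [tb] disappear from the leading terms, and each variable is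
    damped: [x_lag] and [velocity] by the cross term of the energy, [y_lag] by the
    grounded Laplacians; [err] will be damped by strong monotonicity. *)
Lemma energy_rate_along_field mu theta theta1 s :
  energy_rate K tb xs mu s (field theta theta1 s) =
  \sum_i (- theta1 * (err s i * grad s i)
    + mu * (- (x_lag s i ^+ 2 + velocity s i ^+ 2 + x_lag s i * velocity s i)
            - theta1 * K i * grad s i * (velocity s i - x_lag s i)))
  + \sum_i \sum_j (- (theta * theta1) * (y_lag s i j * diffusion s i j)
    + theta1 * (K j / tb i j * y_lag s i j * grad s j)).
Proof.
have Kn i : K i != 0 by rewrite gt_eqF.
have tbn i j : tb i j != 0 by rewrite gt_eqF.
have zdE i : (field theta theta1 s).1.2 0 i = - (theta1 * K i) * grad s i.
  by case: s => [[[x nu] z] y]; rewrite /grad /= mxE.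
have vdE i : velocity (field theta theta1 s) i =
    - x_lag s i - (velocity s i - - (theta1 * K i) * grad s i).
  by case: s {zdE} => [[[x nu] z] y]; rewrite /velocity /x_lag /grad /= !mxE.
have xdE i : (field theta theta1 s).1.1.1 0 i = velocity s i.
  by case: s {zdE vdE} => [[[x nu] z] y].
have ydE i j : (field theta theta1 s).2 i j =
    - (theta * theta1 * tb i j) * diffusion s i j.
  case: s {zdE vdE xdE} => [[[x nu] z] y]; rewrite /diffusion /y_lag /= mxE.
  by congr (_ * (_ + _)); apply: eq_bigr => k _; congr (_ * _); ring.
have xlE i : x_lag (field theta theta1 s) i = velocity s i - - (theta1 * K i) * grad s i.
  by rewrite /x_lag xdE zdE.
rewrite /energy_rate; congr (_ + _).
  apply: eq_bigr => i _; rewrite !xlE !vdE !zdE -/(err s i); congr (_ + _).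
    by field.
  by congr (_ * _); ring.
apply: eq_bigr => i _; apply: eq_bigr => j _.
rewrite {2}/y_lag ydE zdE; field; exact: tbn.
Qed.

Hypotheses (n2 : (2 <= n)%N) (he : simple_graph e) (hconn : connected_graph e).
Variables (m M : R).
Hypotheses (m0 : 0 < m) (mono : strongly_monotone P m).
Hypotheses (hf : forall i, class_C 2 (f i))
  (hM : forall x i j, `|game_hessian f x i j| <= M) (Pxs : P xs = 0).

(* l is the square of a Euclidean Lipschitz constant of each partial gradient;
   E, Q, H are the squared errors of z, of (x, nu) and of y. *)
Let l := M ^+ 2 * n%:R.
Let E (s : state R n) := \sum_i err s i ^+ 2.
Let Q (s : state R n) := \sum_i (x_lag s i ^+ 2 + velocity s i ^+ 2).
Let H (s : state R n) := \sum_i \sum_j y_lag s i j ^+ 2.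
Let G (s : state R n) := \sum_i grad s i ^+ 2.

Let l0 : 0 <= l. Proof. by rewrite mulr_ge0 ?sqr_ge0. Qed.
Let E0 s : 0 <= E s. Proof. by apply: sumr_ge0 => i _; exact: sqr_ge0. Qed.
Let Q0 s : 0 <= Q s.
Proof. by apply: sumr_ge0 => i _; rewrite addr_ge0 ?sqr_ge0. Qed.
Let H0 s : 0 <= H s.
Proof. by apply: sumr_ge0 => i _; apply: sumr_ge0 => j _; exact: sqr_ge0. Qed.

Let error_split s : error_sqr xs s = E s + Q s + H s.
Proof. by rewrite /error_sqr big_split. Qed.

Let grad_consensus_error s :
  \sum_i (grad s i - P s.1.2 0 i) ^+ 2 <= l * H s.
Proof.
rewrite mulr_sumr; apply: ler_sum => i _.
have := pseudo_gradient_lipschitz_sqr hf hM i (row i s.2) s.1.2.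
rewrite [pseudo_gradient f (row i s.2) 0 i]mxE -/(grad s i).
by move=> /le_trans; apply; rewrite -/l; under eq_bigr do rewrite mxE.
Qed.

Let grad_sqr_le s : G s <= 2 * l * (n%:R + 1) * (E s + H s).
Proof.
have hz : \sum_i P s.1.2 0 i ^+ 2 <= n%:R * l * E s.
  apply: (@le_trans _ _ (\sum_(i < n) l * E s)).
    apply: ler_sum => i _; have := pseudo_gradient_lipschitz_sqr hf hM i s.1.2 xs.
    by rewrite -/P Pxs [X in _ - X]mxE subr0.
  by rewrite sumr_const card_ord -[leLHS]mulr_natl mulrA.
have : G s <= 2 * (l * H s) + 2 * (n%:R * l * E s).
  apply: (@le_trans _ _ (2 * \sum_i (grad s i - P s.1.2 0 i) ^+ 2 +
      2 * \sum_i P s.1.2 0 i ^+ 2)).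
    rewrite !mulr_sumr -big_split; apply: ler_sum => i _ /=.
    by have := sqr_ge0 (grad s i - P s.1.2 0 i - P s.1.2 0 i); nra.
  by apply: lerD; rewrite ler_wpM2l.
move=> /le_trans; apply.
have h1 : 0 <= l * E s by rewrite mulr_ge0.
have h2 : 0 <= n%:R * (l * H s) by rewrite mulr_ge0// mulr_ge0.
by lra.
Qed.

(** If the estimates were exact, [grad] would be [P z] and strong monotonicity
    would give [- m E]; half of it pays for the estimation error. *)
Let tracking_term s : - \sum_i err s i * grad s i <= - (m / 2) * E s + l / (2 * m) * H s.
Proof.
have hm : m * E s <= \sum_i err s i * P s.1.2 0 i.
  have := mono s.1.2 xs; rewrite -/(E s) => /le_trans; apply.
  by rewrite Pxs; apply: ler_sum => i _; rewrite [X in _ * (_ - X)]mxE subr0.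
have hd : - \sum_i err s i * (grad s i - P s.1.2 0 i) <=
    m / 2 * E s + (2 * m)^-1 * \sum_i (grad s i - P s.1.2 0 i) ^+ 2.
  rewrite !mulr_sumr -sumrN -big_split; apply: ler_sum => i _ /=.
  set d := grad s i - _; rewrite -subr_ge0.
  rewrite (_ : _ - _ = (2 * m)^-1 * (m * err s i + d) ^+ 2); last first.
    by field; rewrite gt_eqF.
  by rewrite mulr_ge0 ?sqr_ge0// invr_ge0 mulr_ge0// ltW.
have hl : (2 * m)^-1 * \sum_i (grad s i - P s.1.2 0 i) ^+ 2 <= l / (2 * m) * H s.
  rewrite mulrAC mulrC ler_wpM2r ?grad_consensus_error//.
  by rewrite invr_ge0 mulr_ge0// ltW.
have -> : \sum_i err s i * grad s i = \sum_i err s i * P s.1.2 0 i +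
    \sum_i err s i * (grad s i - P s.1.2 0 i).
  by rewrite -big_split; apply: eq_bigr => i _ /=; ring.
by lra.
Qed.

(** For each [j], the column [y_lag . j] of the estimates of player [j]'s action
    sees the Laplacian grounded at [j]; hence the exchange of the two sums. *)
Let consensus_term : exists2 lam : R, 0 < lam &
  forall s, lam * H s <= \sum_i \sum_j y_lag s i j * diffusion s i j.
Proof.
have [lam lam0 hlam] := grounded_laplacian_coercive R n2 he hconn.
exists lam => // s; rewrite /H exchange_big [leRHS]exchange_big mulr_sumr.
by apply: ler_sum => j _; exact: (hlam j (fun i => y_lag s i j)).
Qed.

(** The motion of [z] disturbs the estimates.  By Young's inequality the share of
    the gradient can be made as small as desired, at the price of a multiple of
    [H] that a large [theta] will absorb. *)
Let coupling_term (A : R) : 0 < A -> exists2 C : R, 0 <= C &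
  forall s, \sum_i \sum_j K j / tb i j * y_lag s i j * grad s j <=
    C * H s + n%:R / (2 * A) * G s.
Proof.
move=> A0.
have [k k0 hk] := finite_upper_bound (fun ij : 'I_n * 'I_n => K ij.2 / tb ij.1 ij.2).
exists (A / 2 * k ^+ 2) => [|s]; first by rewrite mulr_ge0 ?sqr_ge0// divr_ge0// ltW.
have -> : n%:R / (2 * A) * G s = \sum_(i < n) (2 * A)^-1 * \sum_j grad s j ^+ 2.
  by rewrite sumr_const card_ord -[RHS]mulr_natl mulrA.
rewrite mulr_sumr -big_split; apply: ler_sum => i _ /=.
rewrite !mulr_sumr -big_split; apply: ler_sum => j _ /=.
set c := K j / tb i j; set y := y_lag s i j; set g := grad s j.
have c0 : 0 <= c by rewrite divr_ge0 ?ltW.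
have ck : c ^+ 2 <= k ^+ 2 by rewrite ler_sqr ?nnegrE ?(ltW k0)//; exact: (hk (i, j)).
apply: (@le_trans _ _ (A / 2 * c ^+ 2 * y ^+ 2 + (2 * A)^-1 * g ^+ 2)).
  rewrite -subr_ge0 (_ : _ - _ = (2 * A)^-1 * (A * c * y - g) ^+ 2).
    by rewrite mulr_ge0 ?sqr_ge0// invr_ge0 mulr_ge0// ltW.
  by field; rewrite gt_eqF.
by rewrite lerD2r ler_wpM2r ?sqr_ge0// ler_wpM2l// divr_ge0// ltW.
Qed.

Let actuator_term : exists2 k : R, 0 < k & forall (theta1 : R) s,
  \sum_i (- (x_lag s i ^+ 2 + velocity s i ^+ 2 + x_lag s i * velocity s i)
            - theta1 * K i * grad s i * (velocity s i - x_lag s i)) <=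
  - (Q s / 4) + theta1 ^+ 2 * k * G s.
Proof.
have [k k0 hk] := finite_upper_bound K.
exists (2 * k ^+ 2) => [|theta1 s]; first by rewrite mulr_gt0// exprn_gt0.
rewrite /Q mulr_suml mulr_sumr -sumrN -big_split; apply: ler_sum => i _ /=.
set u := x_lag s i; set v := velocity s i; set g := grad s i.
have Kk : K i ^+ 2 <= k ^+ 2.
  by rewrite ler_sqr ?nnegrE ?(ltW k0) ?(ltW (K0 i))//; exact: hk.
have h : (theta1 * K i * g) ^+ 2 <= theta1 ^+ 2 * k ^+ 2 * g ^+ 2.
  by rewrite !exprMn ler_wpM2r ?sqr_ge0// ler_wpM2l ?sqr_ge0.
set q := theta1 * K i * g in h *.
have := sqr_ge0 (4 * q + (v - u)); have := sqr_ge0 (u + v); have := sqr_ge0 (u - v).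
by nra.
Qed.

(** [theta_star] makes the diffusion of the estimates dominate the terms in [H].
    The weight [mu] of the mechanical part is chosen after [theta1], which is why
    the decay holds for every [theta1 > 0]. *)
Lemma energy_decay : exists2 theta_star : R, 0 < theta_star &
  forall theta, theta_star < theta -> forall theta1, 0 < theta1 ->
  exists mu c : R, [/\ 0 < mu, 0 < c & forall s,
    energy_rate K tb xs mu s (field theta theta1 s) <= - c * error_sqr xs s].
Proof.
have [lam lam0 hlam] := consensus_term.
have [k k0 hk] := actuator_term.
pose g0 := 2 * l * (n%:R + 1).
have g00 : 0 <= g0 by rewrite mulr_ge0 ?addr_ge0// mulr_ge0.
(* A is chosen so that the gradient costs at most m / 8 in the coupling. *)
pose A := 4 * n%:R * g0 / m + 1.
have A0 : 0 < A.
  rewrite /A ltr_wpDl// divr_ge0 ?(ltW m0)//.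
  by apply: mulr_ge0 g00; exact: mulr_ge0.
have [C C0 hC] := coupling_term A0.
have Am : n%:R / (2 * A) * g0 <= m / 8.
  rewrite mulrAC ler_pdivrMr ?mulr_gt0// (_ : m / 8 * (2 * A) = n%:R * g0 + m / 4).
    by rewrite lerDl divr_ge0// ltW.
  by rewrite /A; field; rewrite gt_eqF.
pose S := l / (2 * m) + C + m / 8 + 1.
have lm0 : 0 <= l / (2 * m).
  by apply: divr_ge0 l0 _; apply: mulr_ge0 => //; exact: ltW.
have m80 : 0 <= m / 8 by apply: divr_ge0 => //; exact: ltW.
have S0 : 0 < S by rewrite /S ltr_wpDl// !addr_ge0.
exists (S / lam) => [|theta]; first by rewrite divr_gt0.
rewrite ltr_pdivrMr// => hS theta1 t0.
(* mu is small enough that the forcing of (x, nu) by dz/dt, of size B (E + H),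
   uses only part of the decay already available for E and H. *)
pose w := Num.min (m / 8) (2^-1 : R).
have w0 : 0 < w by rewrite lt_min divr_gt0//= invr_gt0.
have wm : w <= m / 8 by rewrite ge_min lexx.
have wh : w <= 2^-1 by rewrite ge_min lexx orbT.
pose B := theta1 ^+ 2 * k * g0.
have B0 : 0 <= B by rewrite mulr_ge0// mulr_ge0 ?sqr_ge0// ltW.
pose mu := theta1 * w / (B + 1).
have B1 : 0 < B + 1 by rewrite ltr_wpDl.
have mu0 : 0 < mu by rewrite divr_gt0// mulr_gt0.
have muB : mu * B <= theta1 * w.
  by rewrite /mu mulrAC ler_pdivrMr// ler_wpM2l ?lerDl// ltW// mulr_gt0.
pose c := Num.min (Num.min (theta1 * m / 4) (theta1 / 2)) (mu / 4).
have cE : c <= theta1 * m / 4 by rewrite !ge_min lexx.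
have cH : c <= theta1 / 2 by rewrite !ge_min lexx !orbT.
have cQ : c <= mu / 4 by rewrite !ge_min lexx !orbT.
exists mu, c; split => [//||s].
  by rewrite !lt_min !divr_gt0// mulr_gt0.
rewrite energy_rate_along_field error_split.
rewrite [\sum_i (_ + mu * _)]big_split /= -!mulr_sumr.
rewrite (_ : \sum_i \sum_j (- (theta * theta1) * _ + _) =
   - (theta * theta1) * (\sum_i \sum_j y_lag s i j * diffusion s i j) +
   theta1 * (\sum_i \sum_j K j / tb i j * y_lag s i j * grad s j)); last first.
  rewrite !mulr_sumr -big_split; apply: eq_bigr => i _ /=.
  by rewrite !mulr_sumr -big_split.
have f1 := ler_wpM2l (ltW t0) (tracking_term s).
have f2 := ler_wpM2l (ltW mu0) (hk theta1 s).
have f4 := ler_wpM2l (ltW t0) (hC s).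
have t1 : 0 < theta by apply: lt_trans (_ : 0 < S / lam) _; rewrite ?divr_gt0// ltr_pdivrMr.
have f3 := ler_wpM2l (ltW (mulr_gt0 t1 t0)) (hlam s).
have hG := grad_sqr_le s; rewrite -/g0 in hG.
have EH : 0 <= E s + H s by rewrite addr_ge0.
have g1 : n%:R / (2 * A) * G s <= m / 8 * (E s + H s).
  apply: (@le_trans _ _ (n%:R / (2 * A) * (g0 * (E s + H s)))).
    by rewrite ler_wpM2l// divr_ge0// mulr_ge0// ltW.
  by rewrite mulrA ler_wpM2r.
have g2 : mu * (theta1 ^+ 2 * k * G s) <= theta1 * w * (E s + H s).
  apply: (@le_trans _ _ (mu * (theta1 ^+ 2 * k * (g0 * (E s + H s))))).
    by rewrite ler_wpM2l ?(ltW mu0)// ler_wpM2l// mulr_ge0 ?sqr_ge0// ltW.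
  have -> : theta1 ^+ 2 * k * (g0 * (E s + H s)) = B * (E s + H s) by rewrite /B; ring.
  by rewrite mulrA ler_wpM2r.
have f5 : theta1 * (S * H s) <= theta1 * (theta * lam * H s).
  by rewrite ler_wpM2l ?(ltW t0)// ler_wpM2r// ltW.
have f6 := ler_wpM2l (ltW t0) g1.
have f7 : theta1 * w * (E s + H s) <= theta1 * (m / 8 * E s + 2^-1 * H s).
  by rewrite -mulrA ler_wpM2l ?(ltW t0)// mulrDr; apply: lerD; rewrite ler_wpM2r.
have f8 := ler_wpM2r (E0 s) cE; have f9 := ler_wpM2r (H0 s) cH.
have f10 := ler_wpM2r (Q0 s) cQ.
rewrite /S in f5; lra.
Qed.

End Decay.

(** * Global asymptotic stability *)

Unset Implicit Arguments.
Local Close Scope classical_set_scope.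

Theorem theorem4 (R : realType) (N : nat) (hN : (2 <= N)%N)
    (f : 'I_N -> 'rV[R]_N -> R)
    (hf : forall i : 'I_N, class_C 2 (f i))
    (e : rel 'I_N)
    (he : simple_graph e)
    (hconn : connected_graph e)
    (hmono : exists2 m : R, 0 < m & strongly_monotone (pseudo_gradient f) m)
    (hH : exists M : R, forall (x : 'rV[R]_N) (i j : 'I_N),
        `|game_hessian f x i j| <= M)
    (K : 'I_N -> R) (hK : forall i : 'I_N, 0 < K i)
    (thetabar : 'I_N -> 'I_N -> R)
    (hthetabar : forall i j : 'I_N, 0 < thetabar i j) :
  exists xstar : 'rV[R]_N,
    unique (nash_equilibrium f) xstar /\
    exists2 theta_star : R, 0 < theta_star &
      forall theta : R, theta_star < theta ->
        exists2 theta1_star : R, 0 < theta1_star &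
          forall theta1 : R, 0 < theta1 -> theta1 < theta1_star ->
            globally_asymptotically_stable
              (seeking_dynamics f (adjacency R e)
                 (fun i => theta1 * K i)
                 (fun i j => theta * theta1 * thetabar i j))
              (seeking_equilibrium xstar).
Proof.
have [m m0 mono] := hmono; have [M hM] := hH.
have [xs Pxs uxs] := exists_unique_nash hf hM m0 mono.
exists xs; split=> //.
have [theta_star ts0 decay] :=
  energy_decay hK hthetabar hN he hconn m0 mono hf hM Pxs.
(* The decay holds for every theta1 > 0, so the threshold 1 is arbitrary. *)
exists theta_star => // theta /decay {}decay; exists 1 => // theta1 t0 _.
have [mu [c [mu0 c0 dec]]] := decay theta1 t0.
have [a [b [a0 b0 ab]]] := energy_error_bounds xs hK hthetabar mu0.
have [B B0 hB] := error_le_norm xs.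
set F := seeking_dynamics _ _ _ _; set se := seeking_equilibrium xs.
pose U := energy K thetabar xs mu.
have lo s : a / 2 * `|s - se| ^+ 2 <= U s.
  apply: le_trans (ab s).1; rewrite -mulrA ler_wpM2l ?(ltW a0)//.
  by have := norm_le_error xs s; rewrite -/se; lra.
have up s : U s <= b * B * `|s - se| ^+ 2.
  by apply: le_trans (ab s).2 _; rewrite -mulrA ler_wpM2l ?(ltW b0)//; exact: hB.
have decU s : energy_rate K thetabar xs mu s (F s) <= - (c / b) * U s.
  apply: le_trans (dec s) _; rewrite !mulNr lerN2 -mulrA ler_wpM2l ?(ltW c0)//.
  by rewrite mulrC ler_pdivrMr// mulrC; exact: (ab s).2.
have derU (s : R -> state R N) (t : R) : is_derive t 1 s (F (s t)) ->
    is_derive t 1 (U \o s) (energy_rate K thetabar xs mu (s t) (F (s t))).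
  exact: is_derive_energy.
have a2 : 0 < a / 2 by rewrite divr_gt0.
have bB : 0 < b * B by rewrite mulr_gt0.
have cb : 0 < c / b by rewrite divr_gt0.
have cU : continuous U by exact: energy_continuous.
split.
- exact: seeking_dynamics_equilibrium.
- have lipP : exists M : R, forall i x y,
      `|pseudo_gradient f x 0 i - pseudo_gradient f y 0 i|
        <= M * \sum_j `|x 0 j - y 0 j|.
    by exists M => i x y; exact: pseudo_gradient_lipschitz.
  have [L L0 lipF] := seeking_dynamics_lipschitz (adjacency R e)
    (fun i => theta1 * K i) (fun i j => theta * theta1 * thetabar i j) lipP.
  by move=> s0; exact: (lipschitz_cauchy_problem (state_sup_coordinates R N) s0 L0 lipF).
- by move=> eps eps0; exact: (lyapunov_stable a2 bB cb lo up cU derU decU).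
- by move=> s; exact: (lyapunov_attractive a2 cb lo cU derU decU).
Qed.
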